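(* Let $p>0$ and $s\in(-\infty,-\tfrac12]\cup[\tfrac12,+\infty)$. For an irrotational deep-water Stokes wave, with $\mu_s(E,p)=\frac{1}{c\lambda}\int_0^{c\lambda}E(h^{-1}(q,p))^s\,dq$ the integral mean of the kinetic energy $E=\frac{(u-c)^2+v^2}{2}$ in the moving frame, the function $p\mapsto\mu_s(E,p)$ is convex and non-increasing on $(0,+\infty)$, and $p\mapsto\log\mu_s(E,p)$ is a convex function on $(0,+\infty)$.
   Context: Setting (irrotational deep-water Stokes wave in the moving frame). Let $c>0$ (wave speed), $\lambda>0$ (wavelength), $g>0$ and $P_{atm}$ be constants. In the frame moving with the wave (horizontal coordinate $x$ stands for $x-ct$), the free surface is $y=\eta(x)$, the fluid domain is $D=\{(x,y)\in\mathbb{R}^2:-\infty<y<\eta(x)\}$, $(u(x,y),v(x,y))$ is the velocity field and $P(x,y)$ the pressure. They satisfy - $(u-c)u_x+vu_y=-P_x$, $(u-c)v_x+vv_y=-P_y-g$, $u_x+v_y=0$, $u_y-v_x=0$ in $D$; - $v=(u-c)\eta_x$ and $P=P_{atm}$ on $y=\eta(x)$; - $(u,v)\to(0,0)$ as $y\to-\infty$, uniformly in $x$; - $u(x,y)<c$ for all $-\infty<y\le\eta(x)$. The functions $\eta,u,v,P$ are $\lambda$-periodic in $x$; $\eta,u,P$ are symmetric (even) about the crest line $x=0$; $\eta$ is strictly increasing on $[-\lambda/2,0]$ and strictly decreasing on $[0,\lambda/2]$ (a single crest and trough per period). The velocity field $(u,v)$ is bounded and continuously differentiable throughout the fluid domain.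 Stream function and potential. The stream function $\psi$ is given by $\psi_y=u-c$, $\psi_x=-v$ in $D$, $\psi=0$ on $y=\eta(x)$. The velocity potential $\varphi$ is given by $\varphi_x=\psi_y$, $\varphi_y=-\psi_x$ in $D$, normalized so that $\varphi=c\lambda$ on $x=-\lambda/2$ and $\varphi=0$ on $x=\lambda/2$. The conformal hodograph transform $h=\varphi+i\psi$ (in $z=x+iy$) has $h'=u-c-iv$ and is a conformal bijection from $D$ onto $\Omega=\{(q,p):q\in\mathbb{R},\,0<p<+\infty\}$, written $(q,p)=(\varphi(x,y),\psi(x,y))$; it maps $\{(x,y)\in D:-\lambda/2<x<\lambda/2\}$ onto $\{0<q<c\lambda,\ 0<p<+\infty\}$. Its inverse is $h^{-1}(q,p)=(x,y)$. *)

(* Defs.v *)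
From Stdlib Require Import Reals.
From Coquelicot Require Import Coquelicot.
Open Scope R_scope.

Definition fluid_domain (eta : R -> R) (z : R * R) : Prop :=
  snd z < eta (fst z).

Definition fluid_closure (eta : R -> R) (z : R * R) : Prop :=
  snd z <= eta (fst z).

Definition partial_x (f : R -> R -> R) (x y : R) : R :=
  Derive (fun t => f t y) x.

Definition partial_y (f : R -> R -> R) (x y : R) : R :=
  Derive (fun t => f x t) y.

(* The fields are total functions on the plane; only their values on
   [fluid_closure eta] are constrained.  Continuity up to the free surface is
   what gives the boundary conditions at [y = eta x] their meaning. *)
Record stokes_wave (c lambda g Patm : R)
    (eta : R -> R) (u v P : R -> R -> R) : Prop := {
  sw_eta_diff : forall x, ex_derive eta x;
  (* [ex_diff_n _ 1] holding on the open set [y < eta x] is C^1 regularity. *)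
  sw_u_C1 : forall x y, y < eta x -> ex_diff_n u 1 x y;
  sw_v_C1 : forall x y, y < eta x -> ex_diff_n v 1 x y;
  sw_P_x : forall x y, y < eta x -> ex_derive (fun t => P t y) x;
  sw_P_y : forall x y, y < eta x -> ex_derive (fun t => P x t) y;
  sw_u_cont : continuous_on (fluid_closure eta) (fun z => u (fst z) (snd z));
  sw_v_cont : continuous_on (fluid_closure eta) (fun z => v (fst z) (snd z));
  sw_P_cont : continuous_on (fluid_closure eta) (fun z => P (fst z) (snd z));
  sw_bounded : exists M, forall x y, y <= eta x ->
    Rabs (u x y) <= M /\ Rabs (v x y) <= M;

  sw_euler_x : forall x y, y < eta x ->
    (u x y - c) * partial_x u x y + v x y * partial_y u x y
    = - partial_x P x y;
  sw_euler_y : forall x y, y < eta x ->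
    (u x y - c) * partial_x v x y + v x y * partial_y v x y
    = - partial_y P x y - g;
  sw_incompressible : forall x y, y < eta x ->
    partial_x u x y + partial_y v x y = 0;
  sw_irrotational : forall x y, y < eta x ->
    partial_y u x y - partial_x v x y = 0;

  sw_kinematic : forall x, v x (eta x) = (u x (eta x) - c) * Derive eta x;
  sw_dynamic : forall x, P x (eta x) = Patm;
  sw_deep : forall eps, 0 < eps -> exists Y, forall x y,
    y <= eta x -> y <= Y -> Rabs (u x y) < eps /\ Rabs (v x y) < eps;
  sw_no_stagnation : forall x y, y <= eta x -> u x y < c;

  sw_eta_periodic : forall x, eta (x + lambda) = eta x;
  sw_u_periodic : forall x y, y <= eta x -> u (x + lambda) y = u x y;
  sw_v_periodic : forall x y, y <= eta x -> v (x + lambda) y = v x y;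
  sw_P_periodic : forall x y, y <= eta x -> P (x + lambda) y = P x y;
  sw_eta_even : forall x, eta (- x) = eta x;
  sw_u_even : forall x y, y <= eta x -> u (- x) y = u x y;
  sw_P_even : forall x y, y <= eta x -> P (- x) y = P x y;
  sw_eta_incr : forall x1 x2,
    - lambda / 2 <= x1 -> x1 < x2 -> x2 <= 0 -> eta x1 < eta x2;
  sw_eta_decr : forall x1 x2,
    0 <= x1 -> x1 < x2 -> x2 <= lambda / 2 -> eta x2 < eta x1
}.

Record stream_function (c : R) (eta : R -> R) (u v psi : R -> R -> R)
    : Prop := {
  sf_cont : continuous_on (fluid_closure eta) (fun z => psi (fst z) (snd z));
  sf_y : forall x y, y < eta x -> is_derive (fun t => psi x t) y (u x y - c);
  sf_x : forall x y, y < eta x -> is_derive (fun t => psi t y) x (- v x y);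
  sf_surface : forall x, psi x (eta x) = 0
}.

Record velocity_potential (c lambda : R) (eta : R -> R)
    (psi phi : R -> R -> R) : Prop := {
  vp_x : forall x y, y < eta x ->
    is_derive (fun t => phi t y) x (partial_y psi x y);
  vp_y : forall x y, y < eta x ->
    is_derive (fun t => phi x t) y (- partial_x psi x y);
  vp_left : forall y, y < eta (- lambda / 2) ->
    phi (- lambda / 2) y = c * lambda;
  vp_right : forall y, y < eta (lambda / 2) -> phi (lambda / 2) y = 0
}.

Definition hodograph (phi psi : R -> R -> R) (z : R * R) : R * R :=
  (phi (fst z) (snd z), psi (fst z) (snd z)).

Definition upper_half_plane (w : R * R) : Prop := 0 < snd w.

Record inverse_between (D Omega : R * R -> Prop) (h hinv : R * R -> R * R)
    : Prop := {
  ib_maps : forall z, D z -> Omega (h z);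
  ib_inv_maps : forall w, Omega w -> D (hinv w);
  ib_left : forall z, D z -> hinv (h z) = z;
  ib_right : forall w, Omega w -> h (hinv w) = w
}.

Definition kinetic_energy (c : R) (u v : R -> R -> R) (z : R * R) : R :=
  ((u (fst z) (snd z) - c) ^ 2 + v (fst z) (snd z) ^ 2) / 2.

Definition integral_mean (c lambda : R) (hinv : R * R -> R * R) (s : R)
    (E : R * R -> R) (p : R) : R :=
  / (c * lambda) *
  RInt (fun q => Rpower (E (hinv (q, p))) s) 0 (c * lambda).

Definition positive_reals (p : R) : Prop := 0 < p.

Definition convex_on (I : R -> Prop) (f : R -> R) : Prop :=
  forall a b t, I a -> I b -> 0 <= t <= 1 ->
    f (t * a + (1 - t) * b) <= t * f a + (1 - t) * f b.

Definition nonincreasing_on (I : R -> Prop) (f : R -> R) : Prop :=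
  forall a b, I a -> I b -> a <= b -> f b <= f a.

(* Main.v *)
Require Import Defs.
From Stdlib Require Import Reals Lra Lia Psatz.
From Coquelicot Require Import Coquelicot.
Open Scope R_scope.

(** In the hodograph plane the velocity is a holomorphic function of [q + i p]:
    [c - u + i v] is the negative of the derivative of [h = phi + i psi], and the
    inverse of [h] is holomorphic because [h'] does not vanish.  Since [u < c] it
    takes its values in the right half-plane, so it has a holomorphic power
    [G] of exponent [s], and, after scaling by [sqrt 2], [|G|^2] is the power
    [s] of the kinetic energy.  Moreover [G] takes the same values on the lines
    [q = 0] and [q = c * lambda], which come from two consecutive trough lines.
    So [mu] is the mean [M] of [|G|^2] over a period.

    The Cauchy-Riemann equations and periodicity show that the integral of
    [Re (G (q, p1) conj (G (q, p2)))] over a period depends on [p1 + p2] only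
    (for an exponential [exp (k i (q + i p))] with [k] a multiple of
    [2 pi / (c lambda)] it is a multiple of [exp (- k (p1 + p2))]).  Hence it is
    [M ((p1 + p2) / 2)], and the Cauchy-Schwarz inequality gives
    [M ((p1 + p2) / 2) ^ 2 <= M p1 * M p2].  This uses first derivatives only.
    As [M] is continuous, [ln M] is convex ([energy_integral_log_convex]), and so
    is [M].

    Finally, deep streamlines lie at great depth, where the energy is close to
    [c ^ 2 / 2] ([stokes_energy_deep]), so [M] is bounded for large [p]; a convex
    function on the half-line with this property is non-increasing.

    Most of the work is in [holomorphic_on_inverse]: the contraction principle
    makes [h] locally onto with a Lipschitz choice of preimages, which gives
    the continuity of the given inverse. *)

(** * Complex differentiability in real coordinates *)

(** The pair [(f, g)] stands for the complex function [f + i g], and [(a, b)]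
    for its complex derivative: the Jacobian is multiplication by [a + i b]. *)
Definition complex_diff (f g : R -> R -> R) (x y a b : R) : Prop :=
  differentiable_pt_lim f x y a (- b) /\ differentiable_pt_lim g x y b a.

(** The derivative is required to be continuous, which is what the contraction
    argument for inverses and differentiation under the integral use. *)
Definition holomorphic_on (D : R * R -> Prop) (f g a b : R -> R -> R) : Prop :=
  forall x y, D (x, y) ->
    complex_diff f g x y (a x y) (b x y) /\
    continuity_2d_pt a x y /\ continuity_2d_pt b x y.

Lemma continuity_2d_pt_comp (f u v : R -> R -> R) (x y : R) :
  continuity_2d_pt f (u x y) (v x y) ->
  continuity_2d_pt u x y -> continuity_2d_pt v x y ->
  continuity_2d_pt (fun s t => f (u s t) (v s t)) x y.
Proof.
intros Hf Hu Hv eps.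
destruct (Hf eps) as [d Hd].
destruct (Hu d) as [d1 H1]; destruct (Hv d) as [d2 H2].
assert (Hm : 0 < Rmin d1 d2) by (apply Rmin_pos; apply cond_pos).
exists (mkposreal _ Hm); simpl; intros s t Hs Ht.
pose proof (Rmin_l d1 d2); pose proof (Rmin_r d1 d2).
apply Hd; [apply H1 | apply H2]; lra.
Qed.

Lemma continuity_2d_pt_sum_squares (f g : R -> R -> R) (x y : R) :
  continuity_2d_pt f x y -> continuity_2d_pt g x y ->
  continuity_2d_pt (fun s t => f s t ^ 2 + g s t ^ 2) x y.
Proof.
intros Hf Hg; unfold pow; apply continuity_2d_pt_plus;
  repeat apply continuity_2d_pt_mult; trivial; apply continuity_2d_pt_const.
Qed.

Lemma differentiable_pt_lim_x (f : R -> R -> R) (x y lx ly : R) :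
  differentiable_pt_lim f x y lx ly -> is_derive (fun t => f t y) x lx.
Proof.
intros H; apply is_derive_Reals.
replace lx with (lx * 1 + ly * 0) by ring.
apply (derivable_pt_lim_comp_2d f (fun t => t) (fun _ => y)); trivial.
- apply derivable_pt_lim_id.
- apply derivable_pt_lim_const.
Qed.

Lemma differentiable_pt_lim_y (f : R -> R -> R) (x y lx ly : R) :
  differentiable_pt_lim f x y lx ly -> is_derive (fun t => f x t) y ly.
Proof.
intros H; apply is_derive_Reals.
replace ly with (lx * 0 + ly * 1) by ring.
apply (derivable_pt_lim_comp_2d f (fun _ => x) (fun t => t)); trivial.
- apply derivable_pt_lim_const.
- apply derivable_pt_lim_id.
Qed.

Lemma complex_diff_continuity (f g : R -> R -> R) (x y a b : R) :
  complex_diff f g x y a b -> continuity_2d_pt f x y /\ continuity_2d_pt g x y.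
Proof.
intros [H1 H2]; split; apply differentiable_continuity_pt; eexists; eexists;
  eassumption.
Qed.

Lemma complex_diff_comp (F G f g : R -> R -> R) (x y A B a b : R) :
  complex_diff F G (f x y) (g x y) A B -> complex_diff f g x y a b ->
  complex_diff (fun s t => F (f s t) (g s t)) (fun s t => G (f s t) (g s t))
    x y (A * a - B * b) (A * b + B * a).
Proof.
intros [HF HG] [Hf Hg]; split.
- replace (A * a - B * b) with (A * a + - B * b) by ring.
  replace (- (A * b + B * a)) with (A * - b + - B * a) by ring.
  now apply differentiable_pt_lim_comp.
- replace (A * b + B * a) with (B * a + A * b) by ring.
  replace (A * a - B * b) with (B * - b + A * a) by ring.
  now apply differentiable_pt_lim_comp.
Qed.

Lemma holomorphic_on_comp (D D' : R * R -> Prop)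
    (F G A B f g a b : R -> R -> R) :
  (forall x y, D (x, y) -> D' (f x y, g x y)) ->
  holomorphic_on D' F G A B -> holomorphic_on D f g a b ->
  holomorphic_on D
    (fun x y => F (f x y) (g x y)) (fun x y => G (f x y) (g x y))
    (fun x y => A (f x y) (g x y) * a x y - B (f x y) (g x y) * b x y)
    (fun x y => A (f x y) (g x y) * b x y + B (f x y) (g x y) * a x y).
Proof.
intros Hmap HF Hf x y Dxy.
destruct (Hf x y Dxy) as (Hd & Ha & Hb).
destruct (HF _ _ (Hmap x y Dxy)) as (Hd' & HA & HB).
destruct (complex_diff_continuity _ _ _ _ _ _ Hd) as [Cf Cg].
split; [now apply complex_diff_comp | ].
split; [apply continuity_2d_pt_minus | apply continuity_2d_pt_plus];
  apply continuity_2d_pt_mult; trivial; now apply continuity_2d_pt_comp.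
Qed.

Lemma differentiable_of_partials (f fx : R -> R -> R) (x y fy : R) :
  locally_2d (fun s t => is_derive (fun z => f z t) s (fx s t)) x y ->
  is_derive (fun t => f x t) y fy -> continuity_2d_pt fx x y ->
  differentiable_pt_lim f x y (fx x y) fy.
Proof.
intros Hx Hy Hc.
apply filterdiff_differentiable_pt_lim.
apply (is_derive_filterdiff f x y fx fy); trivial.
- now apply locally_2d_locally in Hx.
- now apply continuity_2d_pt_filterlim in Hc.
Qed.

(** Continuous partial derivatives give total differentiability; the
    Cauchy-Riemann equations are built into the four derivatives. *)
Lemma holomorphic_of_partials (D : R * R -> Prop) (f g a b : R -> R -> R) :
  open D ->
  (forall x y, D (x, y) -> is_derive (fun t => f t y) x (a x y)) ->
  (forall x y, D (x, y) -> is_derive (fun t => f x t) y (- b x y)) ->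
  (forall x y, D (x, y) -> is_derive (fun t => g t y) x (b x y)) ->
  (forall x y, D (x, y) -> is_derive (fun t => g x t) y (a x y)) ->
  (forall x y, D (x, y) -> continuity_2d_pt a x y) ->
  (forall x y, D (x, y) -> continuity_2d_pt b x y) ->
  holomorphic_on D f g a b.
Proof.
intros HD Hfx Hfy Hgx Hgy Ha Hb x y Dxy.
assert (HL : locally_2d (fun s t => D (s, t)) x y).
{ apply locally_2d_locally.
  apply filter_imp with D; [now intros [? ?] | now apply HD]. }
split; [split | now split; auto]; apply differentiable_of_partials; auto;
  (eapply locally_2d_impl; [ | exact HL]); apply locally_2d_forall; auto.
Qed.

(** * Inverse functions *)

(** The contraction principle on a square, for the sup norm, written with
    componentwise bounds. *)
Lemma plane_fixed_point (k1 k2 : R -> R -> R) (x0 y0 r e : R) :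
  (forall x y x' y' d, Rabs (x - x0) <= r -> Rabs (y - y0) <= r ->
     Rabs (x' - x0) <= r -> Rabs (y' - y0) <= r ->
     Rabs (x - x') <= d -> Rabs (y - y') <= d ->
     Rabs (k1 x y - k1 x' y') <= d / 2 /\ Rabs (k2 x y - k2 x' y') <= d / 2) ->
  Rabs (k1 x0 y0 - x0) <= e -> Rabs (k2 x0 y0 - y0) <= e -> 2 * e <= r ->
  exists x y, k1 x y = x /\ k2 x y = y /\
    Rabs (x - x0) <= 2 * e /\ Rabs (y - y0) <= 2 * e.
Proof.
intros Hk H1 H2 Her.
assert (He : 0 <= e) by (pose proof (Rabs_pos (k1 x0 y0 - x0)); lra).
pose (z := fix z n := match n with
  | 0%nat => (x0, y0)
  | S n => (k1 (fst (z n)) (snd (z n)), k2 (fst (z n)) (snd (z n))) end).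
assert (Hpos : forall n, 0 < (1 / 2) ^ n) by (intro; apply pow_lt; lra).
assert (near : forall n,
  Rabs (fst (z n) - x0) <= 2 * e * (1 - (1 / 2) ^ n) /\
  Rabs (snd (z n) - y0) <= 2 * e * (1 - (1 / 2) ^ n) /\
  Rabs (fst (z (S n)) - fst (z n)) <= e * (1 / 2) ^ n /\
  Rabs (snd (z (S n)) - snd (z n)) <= e * (1 / 2) ^ n).
{ induction n as [ | n (I1 & I2 & I3 & I4)].
  - simpl; rewrite !Rminus_diag, Rabs_R0; repeat split; lra.
  - assert (B1 : Rabs (fst (z (S n)) - x0) <= 2 * e * (1 - (1 / 2) ^ S n)).
    { replace (fst (z (S n)) - x0)
        with ((fst (z (S n)) - fst (z n)) + (fst (z n) - x0)) by ring.
      eapply Rle_trans; [apply Rabs_triang | ].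
      replace ((1 / 2) ^ S n) with (1 / 2 * (1 / 2) ^ n) by reflexivity; lra. }
    assert (B2 : Rabs (snd (z (S n)) - y0) <= 2 * e * (1 - (1 / 2) ^ S n)).
    { replace (snd (z (S n)) - y0)
        with ((snd (z (S n)) - snd (z n)) + (snd (z n) - y0)) by ring.
      eapply Rle_trans; [apply Rabs_triang | ].
      replace ((1 / 2) ^ S n) with (1 / 2 * (1 / 2) ^ n) by reflexivity; lra. }
    split; [exact B1 | split; [exact B2 | ]].
    replace (e * (1 / 2) ^ S n) with (e * (1 / 2) ^ n / 2) by (simpl; field).
    assert (P : forall m, 2 * e * (1 - (1 / 2) ^ m) <= r).
    { intros m; pose proof (Hpos m); nra. }
    apply (Hk (fst (z (S n))) (snd (z (S n))) (fst (z n)) (snd (z n)));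
      trivial; eapply Rle_trans; eauto. }
assert (tail : forall n k,
  Rabs (fst (z (n + k)%nat) - fst (z n)) <= 2 * e * ((1 / 2) ^ n - (1 / 2) ^ (n + k)) /\
  Rabs (snd (z (n + k)%nat) - snd (z n)) <= 2 * e * ((1 / 2) ^ n - (1 / 2) ^ (n + k))).
{ intros n; induction k as [ | k [I1 I2]].
  - rewrite Nat.add_0_r, !Rminus_diag, Rabs_R0; lra.
  - replace (n + S k)%nat with (S (n + k)) by lia.
    destruct (near (n + k)%nat) as (_ & _ & N1 & N2).
    replace ((1 / 2) ^ S (n + k)) with (1 / 2 * (1 / 2) ^ (n + k)) by reflexivity.
    split.
    + replace (fst (z (S (n + k))) - fst (z n)) with
        ((fst (z (S (n + k))) - fst (z (n + k)%nat)) + (fst (z (n + k)%nat) - fst (z n)))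
        by ring.
      eapply Rle_trans; [apply Rabs_triang | lra].
    + replace (snd (z (S (n + k))) - snd (z n)) with
        ((snd (z (S (n + k))) - snd (z (n + k)%nat)) + (snd (z (n + k)%nat) - snd (z n)))
        by ring.
      eapply Rle_trans; [apply Rabs_triang | lra]. }
assert (small : forall C eps, 0 <= C -> 0 < eps -> exists n, C * (1 / 2) ^ n < eps).
{ intros C eps HC Heps.
  destruct (pow_lt_1_zero (1 / 2)) with (y := eps / (C + 1)) as [n Hn].
  - rewrite Rabs_pos_eq; lra.
  - apply Rdiv_lt_0_compat; lra.
  - exists n; specialize (Hn n (le_n n)).
    rewrite Rabs_pos_eq in Hn by (apply Rlt_le, Hpos).
    apply Rlt_div_r in Hn; [ | lra].
    pose proof (Hpos n); nra. }
assert (Hlim : forall w : nat -> R,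
  (forall n k, Rabs (w (n + k)%nat - w n) <= 2 * e * ((1 / 2) ^ n - (1 / 2) ^ (n + k))) ->
  exists l, forall n, Rabs (l - w n) <= 2 * e * (1 / 2) ^ n).
{ intros w Hw.
  assert (Hw' : forall n k, Rabs (w (n + k)%nat - w n) <= 2 * e * (1 / 2) ^ n).
  { intros n k; eapply Rle_trans; [apply Hw | ].
    pose proof (Hpos (n + k)%nat); nra. }
  assert (Hc : ex_lim_seq_cauchy w).
  { intros eps.
    destruct (small (4 * e) eps) as [N HN]; [lra | apply cond_pos | ].
    exists N; intros n m Hn Hm.
    replace n with (N + (n - N))%nat by lia.
    replace m with (N + (m - N))%nat by lia.
    replace (w (N + (n - N))%nat - w (N + (m - N))%nat)
      with ((w (N + (n - N))%nat - w N) - (w (N + (m - N))%nat - w N)) by ring.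
    eapply Rle_lt_trans; [apply Rabs_triang | rewrite Rabs_Ropp].
    pose proof (Hw' N (n - N)%nat); pose proof (Hw' N (m - N)%nat); lra. }
  apply ex_lim_seq_cauchy_corr in Hc; destruct Hc as [l Hl].
  exists l; intros n.
  assert (HL : is_lim_seq (fun k => Rabs (w (n + k)%nat - w n)) (Rabs (l - w n))).
  { apply (is_lim_seq_abs _ (l - w n)).
    apply is_lim_seq_minus'; [ | apply is_lim_seq_const].
    apply is_lim_seq_ext with (fun k => w (k + n)%nat).
    - intros k; now rewrite Nat.add_comm.
    - now apply is_lim_seq_incr_n. }
  exact (is_lim_seq_le _ _ (Finite _) (Finite _) (Hw' n) HL (is_lim_seq_const _)). }
destruct (Hlim (fun n => fst (z n))) as [x Hx]; [intros; apply tail | ].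
destruct (Hlim (fun n => snd (z n))) as [y Hy]; [intros; apply tail | ].
assert (Bx : Rabs (x - x0) <= 2 * e) by (specialize (Hx 0%nat); simpl in Hx; lra).
assert (By : Rabs (y - y0) <= 2 * e) by (specialize (Hy 0%nat); simpl in Hy; lra).
assert (Hfix : forall n, Rabs (k1 x y - x) <= 2 * e * (1 / 2) ^ n /\
                         Rabs (k2 x y - y) <= 2 * e * (1 / 2) ^ n).
{ intros n.
  destruct (near n) as (N1 & N2 & _ & _).
  assert (P : 2 * e * (1 - (1 / 2) ^ n) <= r) by (pose proof (Hpos n); nra).
  destruct (Hk x y (fst (z n)) (snd (z n)) (2 * e * (1 / 2) ^ n)) as [K1 K2]; trivial;
    try lra.
  pose proof (Hx (S n)) as X; pose proof (Hy (S n)) as Y.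
  replace ((1 / 2) ^ S n) with (1 / 2 * (1 / 2) ^ n) in X, Y by reflexivity.
  change (fst (z (S n))) with (k1 (fst (z n)) (snd (z n))) in X.
  change (snd (z (S n))) with (k2 (fst (z n)) (snd (z n))) in Y.
  split.
  - replace (k1 x y - x) with ((k1 x y - k1 (fst (z n)) (snd (z n)))
      - (x - k1 (fst (z n)) (snd (z n)))) by ring.
    eapply Rle_trans; [apply Rabs_triang | rewrite Rabs_Ropp; lra].
  - replace (k2 x y - y) with ((k2 x y - k2 (fst (z n)) (snd (z n)))
      - (y - k2 (fst (z n)) (snd (z n)))) by ring.
    eapply Rle_trans; [apply Rabs_triang | rewrite Rabs_Ropp; lra]. }
assert (Hzero : forall t, (forall n, Rabs t <= 2 * e * (1 / 2) ^ n) -> t = 0).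
{ intros t Ht; destruct (Req_dec t 0) as [ | Ht0]; trivial; exfalso.
  destruct (small (2 * e) (Rabs t)) as [n Hn];
    [lra | now apply Rabs_pos_lt | specialize (Ht n); lra]. }
exists x, y; repeat split; trivial; apply Rminus_diag_uniq, Hzero; apply Hfix.
Qed.

(** Gives their known values to the terms [Derive h y] that [auto_derive] leaves
    for functions without a closed form. *)
Ltac rewrite_derive := repeat match goal with
  | H : is_derive ?f ?x ?l |- context [Derive ?h ?y] =>
      replace (Derive h y) with l by (symmetry; exact (is_derive_unique f x l H))
  end.

Lemma sum_squares_neq_0 (a b : R) : a ^ 2 + b ^ 2 <> 0 -> 0 < a ^ 2 + b ^ 2.
Proof. intros H; pose proof (pow2_ge_0 a); pose proof (pow2_ge_0 b); lra. Qed.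

Lemma Rabs_combination (A B N s t m : R) :
  0 < N -> Rabs s <= m -> Rabs t <= m ->
  Rabs ((A * s + B * t) / N) <= (Rabs A + Rabs B) / N * m.
Proof.
intros PN Hs Ht.
pose proof (Rabs_pos A); pose proof (Rabs_pos B).
assert (Rabs A * Rabs s <= Rabs A * m) by now apply Rmult_le_compat_l.
assert (Rabs B * Rabs t <= Rabs B * m) by now apply Rmult_le_compat_l.
pose proof (Rabs_triang (A * s) (B * t)) as T; rewrite !Rabs_mult in T.
assert (PiN : 0 < / N) by now apply Rinv_0_lt_compat.
unfold Rdiv; rewrite Rabs_mult, (Rabs_pos_eq (/ N)) by lra.
replace ((Rabs A + Rabs B) * / N * m) with ((Rabs A + Rabs B) * m * / N) by ring.
apply Rmult_le_compat_r; lra.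
Qed.

(** Move first horizontally, then vertically, without leaving the square. *)
Lemma Lipschitz_of_partials (k kx ky : R -> R -> R) (x0 y0 r m : R) :
  (forall x y, Rabs (x - x0) <= r -> Rabs (y - y0) <= r ->
     is_derive (fun t => k t y) x (kx x y) /\
     is_derive (fun t => k x t) y (ky x y) /\
     Rabs (kx x y) <= m /\ Rabs (ky x y) <= m) ->
  forall x y x' y' d, Rabs (x - x0) <= r -> Rabs (y - y0) <= r ->
     Rabs (x' - x0) <= r -> Rabs (y' - y0) <= r ->
     Rabs (x - x') <= d -> Rabs (y - y') <= d ->
     Rabs (k x y - k x' y') <= 2 * m * d.
Proof.
intros Hk x y x' y' d Hx Hy Hx' Hy' Dx Dy.
assert (between : forall s s' t z, Rabs (s - z) <= r -> Rabs (s' - z) <= r ->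
  Rmin s s' <= t <= Rmax s s' -> Rabs (t - z) <= r).
{ intros s s' t z; unfold Rmin, Rmax; destruct (Rle_dec s s');
    unfold Rabs; repeat destruct Rcase_abs; lra. }
destruct (MVT_abs (fun t => k t y) (fun t => kx t y) x' x) as (t1 & E1 & B1).
{ intros t Ht; apply is_derive_Reals, Hk; eauto. }
destruct (MVT_abs (fun t => k x' t) (fun t => ky x' t) y' y) as (t2 & E2 & B2).
{ intros t Ht; apply is_derive_Reals, Hk; eauto. }
destruct (Hk t1 y) as (_ & _ & M1 & _); eauto.
destruct (Hk x' t2) as (_ & _ & _ & M2); eauto.
replace (k x y - k x' y') with ((k x y - k x' y) + (k x' y - k x' y')) by ring.
eapply Rle_trans; [apply Rabs_triang | ].
rewrite E1, E2.
pose proof (Rabs_pos (kx t1 y)); pose proof (Rabs_pos (ky x' t2)).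
pose proof (Rabs_pos (x - x')); pose proof (Rabs_pos (y - y')).
assert (Rabs (kx t1 y) * Rabs (x - x') <= m * d) by (apply Rmult_le_compat; trivial).
assert (Rabs (ky x' t2) * Rabs (y - y') <= m * d) by (apply Rmult_le_compat; trivial).
lra.
Qed.

(** The preimage of [q + i p] is the fixed point of the simplified Newton map
    [z |-> z - (f z + i g z - (q + i p)) / h'(z0)], a contraction near [z0]. *)
Lemma holomorphic_locally_onto (D : R * R -> Prop) (f g a b : R -> R -> R)
    (x0 y0 : R) :
  open D -> holomorphic_on D f g a b -> D (x0, y0) ->
  a x0 y0 ^ 2 + b x0 y0 ^ 2 <> 0 ->
  exists C delta, 0 < C /\ 0 < delta /\ forall q p e,
    Rabs (q - f x0 y0) <= e -> Rabs (p - g x0 y0) <= e -> e <= delta ->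
    exists x y, D (x, y) /\ f x y = q /\ g x y = p /\
      Rabs (x - x0) <= C * e /\ Rabs (y - y0) <= C * e.
Proof.
intros HD Hf D0 HN.
destruct (Hf x0 y0 D0) as (_ & Ca & Cb).
set (A := a x0 y0) in *; set (B := b x0 y0) in *.
set (N := A ^ 2 + B ^ 2) in *.
assert (PN : 0 < N) by now apply sum_squares_neq_0.
assert (HN' : A * A + B * B <> 0).
{ intros Z; apply HN; unfold N; rewrite <- Z; ring. }
pose (K := (Rabs A + Rabs B) / N).
assert (PK : 0 <= K).
{ apply Rle_div_r; [lra | ].
  pose proof (Rabs_pos A); pose proof (Rabs_pos B); lra. }
assert (comb : forall s t m, Rabs s <= m -> Rabs t <= m ->
  Rabs ((A * s + B * t) / N) <= K * m /\ Rabs ((A * s + - B * t) / N) <= K * m).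
{ intros s t m Hs Ht; split; [now apply Rabs_combination | ].
  unfold K; rewrite <- (Rabs_Ropp B); now apply Rabs_combination. }
(* With this accuracy of [a + i b], the partial derivatives of the Newton map
   are at most 1/4. *)
assert (Pw : 0 < / (4 * (K + 1))) by (apply Rinv_0_lt_compat; lra).
set (w := mkposreal _ Pw).
assert (HKw : K * w <= 1 / 4).
{ simpl; apply (Rmult_le_reg_r (4 * (K + 1))); [lra | ].
  rewrite Rmult_assoc, Rinv_l; lra. }
destruct (Ca w) as [da Hda]; destruct (Cb w) as [db Hdb].
destruct (HD (x0, y0) D0) as [d0 Hd0].
pose (r := Rmin d0 (Rmin da db) / 2).
assert (Pr : 0 < r).
{ unfold r; apply Rdiv_lt_0_compat; [ | lra].
  repeat apply Rmin_pos; apply cond_pos. }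
assert (Hr : r < d0 /\ r < da /\ r < db).
{ pose proof (Rmin_l d0 (Rmin da db)); pose proof (Rmin_r d0 (Rmin da db)).
  pose proof (Rmin_l da db); pose proof (Rmin_r da db); unfold r in *; lra. }
assert (loc : forall x y, Rabs (x - x0) <= r -> Rabs (y - y0) <= r -> D (x, y)).
{ intros x y Hx Hy; apply Hd0; split; simpl;
    (eapply Rle_lt_trans; [eassumption | apply Hr]). }
exists (2 * K + 1), (r / (2 * K + 1)).
split; [lra | split; [apply Rdiv_lt_0_compat; lra | ]].
intros q p e Hq Hp He.
assert (Pe : 0 <= e) by (pose proof (Rabs_pos (q - f x0 y0)); lra).
apply Rle_div_r in He; [ | lra].
pose (k1 := fun x y => x - (A * (f x y - q) + B * (g x y - p)) / N).
pose (k2 := fun x y => y - (A * (g x y - p) + - B * (f x y - q)) / N).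
pose (kd := fun x y => (A * (A - a x y) + B * (B - b x y)) / N).
pose (ke := fun x y => (A * (B - b x y) + - B * (A - a x y)) / N).
assert (Hsmall : forall x y, Rabs (x - x0) <= r -> Rabs (y - y0) <= r ->
  Rabs (kd x y) <= 1 / 4 /\ Rabs (ke x y) <= 1 / 4 /\ Rabs (- ke x y) <= 1 / 4).
{ intros x y Hx Hy; rewrite Rabs_Ropp; unfold kd, ke.
  assert (W1 : Rabs (A - a x y) <= w).
  { rewrite Rabs_minus_sym; apply Rlt_le, Hda; lra. }
  assert (W2 : Rabs (B - b x y) <= w).
  { rewrite Rabs_minus_sym; apply Rlt_le, Hdb; lra. }
  destruct (comb _ _ w W1 W2) as [Q1 _]; destruct (comb _ _ w W2 W1) as [_ Q2].
  split; [ | split]; lra. }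
assert (deriv : forall x y, D (x, y) ->
  is_derive (fun t => k1 t y) x (kd x y) /\
  is_derive (fun t => k1 x t) y (- ke x y) /\
  is_derive (fun t => k2 t y) x (ke x y) /\
  is_derive (fun t => k2 x t) y (kd x y)).
{ intros x y Dxy; destruct (Hf x y Dxy) as ([F G] & _).
  pose proof (differentiable_pt_lim_x _ _ _ _ _ F) as Fx.
  pose proof (differentiable_pt_lim_y _ _ _ _ _ F) as Fy.
  pose proof (differentiable_pt_lim_x _ _ _ _ _ G) as Gx.
  pose proof (differentiable_pt_lim_y _ _ _ _ _ G) as Gy.
  assert (lin : forall (E F1 G1 : R -> R) z E' F' G' al be l,
    is_derive E z E' -> is_derive F1 z F' -> is_derive G1 z G' ->
    l = E' - (al * F' + be * G') / N ->
    forall q1 p1, is_derive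
      (fun t => E t - (al * (F1 t - q1) + be * (G1 t - p1)) / N) z l).
  { intros E F1 G1 z E' F' G' al be l HE HF1 HG1 -> q1 p1.
    auto_derive; [repeat split; trivial; eexists; eassumption | ].
    rewrite_derive; field; exact HN. }
  unfold k1, k2, kd, ke; split; [ | split; [ | split]].
  - eapply (lin (fun t => t)); [apply is_derive_id | exact Fx | exact Gx | ].
    unfold one, N; simpl; field; exact HN'.
  - eapply (lin (fun _ => x)); [apply is_derive_const | exact Fy | exact Gy | ].
    unfold zero, N; simpl; field; exact HN'.
  - eapply (lin (fun _ => y)); [apply is_derive_const | exact Gx | exact Fx | ].
    unfold zero, N; simpl; field; exact HN'.
  - eapply (lin (fun t => t)); [apply is_derive_id | exact Gy | exact Fy | ].
    unfold one, N; simpl; field; exact HN'. }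
assert (L1 := Lipschitz_of_partials k1 kd (fun x y => - ke x y) x0 y0 r (1 / 4)).
assert (L2 := Lipschitz_of_partials k2 ke kd x0 y0 r (1 / 4)).
destruct (plane_fixed_point k1 k2 x0 y0 r (K * e)) as (x & y & F1 & F2 & Bx & By).
- intros x y x' y' d Hx Hy Hx' Hy' Dx Dy.
  replace (d / 2) with (2 * (1 / 4) * d) by field.
  split; [apply L1 | apply L2]; trivial; intros s t Hs Ht;
    destruct (deriv s t (loc s t Hs Ht)) as (? & ? & ? & ?);
    destruct (Hsmall s t Hs Ht) as (? & ? & ?); auto.
- unfold k1.
  rewrite Rabs_minus_sym in Hq; rewrite Rabs_minus_sym in Hp.
  destruct (comb _ _ e Hq Hp) as [Q _].
  match goal with |- Rabs (_ - ?z - _) <= _ => replace (x0 - z - x0) with (- z) by ring end.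
  now rewrite Rabs_Ropp.
- unfold k2.
  rewrite Rabs_minus_sym in Hq; rewrite Rabs_minus_sym in Hp.
  destruct (comb _ _ e Hp Hq) as [_ Q].
  match goal with |- Rabs (_ - ?z - _) <= _ => replace (y0 - z - y0) with (- z) by ring end.
  now rewrite Rabs_Ropp.
- nra.
- exists x, y.
  assert (HKe : 2 * (K * e) <= (2 * K + 1) * e) by nra.
  split; [apply loc; nra | ].
  assert (E1 : (A * (f x y - q) + B * (g x y - p)) / N = 0) by (unfold k1 in F1; lra).
  assert (E2 : (A * (g x y - p) + - B * (f x y - q)) / N = 0) by (unfold k2 in F2; lra).
  assert (S1 : f x y - q = A * ((A * (f x y - q) + B * (g x y - p)) / N)
    - B * ((A * (g x y - p) + - B * (f x y - q)) / N)) by (unfold N; field; exact HN).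
  assert (S2 : g x y - p = B * ((A * (f x y - q) + B * (g x y - p)) / N)
    + A * ((A * (g x y - p) + - B * (f x y - q)) / N)) by (unfold N; field; exact HN).
  rewrite E1, E2 in S1, S2; repeat split; lra.
Qed.

(** The local preimage found in [holomorphic_locally_onto] must be the global
    one, so the inverse is locally Lipschitz, and its derivative is forced by
    that of [f + i g]. *)
Lemma holomorphic_on_inverse (D Omega : R * R -> Prop) (f g a b : R -> R -> R)
    (hinv : R * R -> R * R) :
  open D -> open Omega -> holomorphic_on D f g a b ->
  (forall x y, D (x, y) -> a x y ^ 2 + b x y ^ 2 <> 0) ->
  inverse_between D Omega (hodograph f g) hinv ->
  let X := fun q p => fst (hinv (q, p)) in
  let Y := fun q p => snd (hinv (q, p)) in
  let n := fun x y => a x y ^ 2 + b x y ^ 2 in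
  holomorphic_on Omega X Y
    (fun q p => a (X q p) (Y q p) / n (X q p) (Y q p))
    (fun q p => - (b (X q p) (Y q p) / n (X q p) (Y q p))).
Proof.
intros HD HO Hf Hnz Hinv X Y n q0 p0 O0.
destruct Hinv as [Hmap Hinvmap Hleft Hright].
assert (DXY : forall q p, Omega (q, p) -> D (X q p, Y q p)).
{ intros q p Oqp; unfold X, Y; rewrite <- surjective_pairing; auto. }
assert (fXY : forall q p, Omega (q, p) ->
  f (X q p) (Y q p) = q /\ g (X q p) (Y q p) = p).
{ intros q p Oqp; pose proof (Hright _ Oqp) as E; unfold hodograph in E.
  now injection E. }
assert (XY : forall x y, D (x, y) -> X (f x y) (g x y) = x /\ Y (f x y) (g x y) = y).
{ intros x y Dxy; pose proof (Hleft _ Dxy) as E; unfold hodograph in E; simpl in E.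
  unfold X, Y; rewrite E; auto. }
pose proof (DXY _ _ O0) as D0; destruct (fXY _ _ O0) as [Ef Eg].
set (x0 := X q0 p0) in *; set (y0 := Y q0 p0) in *.
destruct (Hf x0 y0 D0) as ([F G] & Ca & Cb).
assert (HN : 0 < n x0 y0) by (apply sum_squares_neq_0, Hnz, D0).
destruct (holomorphic_locally_onto D f g a b x0 y0) as (C & delta & PC & Pd & Hloc);
  trivial; [now apply Hnz | ].
rewrite Ef, Eg in Hloc.
destruct (HO (q0, p0) O0) as [dO HdO].
assert (Pd' : 0 < Rmin delta dO) by (apply Rmin_pos; [lra | apply cond_pos]).
set (d1 := mkposreal _ Pd').
assert (Hd1 : d1 <= delta /\ d1 <= dO) by (split; [apply Rmin_l | apply Rmin_r]).
clearbody d1.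
assert (HOd : forall q p, Rabs (q - q0) < d1 -> Rabs (p - p0) < d1 -> Omega (q, p)).
{ intros q p Hq Hp; apply HdO; split; simpl;
    (eapply Rlt_le_trans; [eassumption | apply Hd1]). }
assert (HLip : forall q p, Rabs (q - q0) < d1 -> Rabs (p - p0) < d1 ->
  Rabs (X q p - x0) <= C * Rmax (Rabs (q - q0)) (Rabs (p - p0)) /\
  Rabs (Y q p - y0) <= C * Rmax (Rabs (q - q0)) (Rabs (p - p0))).
{ intros q p Hq Hp.
  destruct (Hloc q p (Rmax (Rabs (q - q0)) (Rabs (p - p0))))
    as (x & y & Dxy & E1 & E2 & Bx & By).
  - apply Rmax_l.
  - apply Rmax_r.
  - apply Rlt_le, Rmax_lub_lt; lra.
  - destruct (XY x y Dxy) as [EX EY]; rewrite E1, E2 in EX, EY.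
    now rewrite EX, EY. }
assert (HcXY : continuity_2d_pt X q0 p0 /\ continuity_2d_pt Y q0 p0).
{ assert (Hc : forall Z : R -> R -> R,
    (forall q p, Rabs (q - q0) < d1 -> Rabs (p - p0) < d1 ->
      Rabs (Z q p - Z q0 p0) <= C * Rmax (Rabs (q - q0)) (Rabs (p - p0))) ->
    continuity_2d_pt Z q0 p0).
  { intros Z HZ eps.
    assert (Pm : 0 < Rmin d1 (eps / C)).
    { apply Rmin_pos; [apply cond_pos | apply Rdiv_lt_0_compat; [apply cond_pos | lra]]. }
    exists (mkposreal _ Pm); simpl; intros q p Hq Hp.
    pose proof (Rmin_l d1 (eps / C)); pose proof (Rmin_r d1 (eps / C)).
    eapply Rle_lt_trans; [apply HZ; simpl in *; lra | ].
    rewrite Rmult_comm; apply Rlt_div_r; [lra | apply Rmax_lub_lt; lra]. }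
  split; apply Hc; intros q p Hq Hp; now apply HLip. }
destruct HcXY as [HcX HcY].
assert (Hcn : continuity_2d_pt n x0 y0).
{ now apply continuity_2d_pt_sum_squares. }
assert (Hcomp : forall k, continuity_2d_pt k x0 y0 ->
  continuity_2d_pt (fun q p => k (X q p) (Y q p) / n (X q p) (Y q p)) q0 p0).
{ intros k Hk; unfold Rdiv; apply continuity_2d_pt_mult.
  - now apply continuity_2d_pt_comp.
  - apply continuity_2d_pt_inv; [now apply continuity_2d_pt_comp | ].
    apply Rgt_not_eq, HN. }
split; [ | split; [now apply Hcomp | now apply continuity_2d_pt_opp, Hcomp]].
fold x0 y0; set (A := a x0 y0) in *; set (B := b x0 y0) in *.
assert (HNe : n x0 y0 = A ^ 2 + B ^ 2) by reflexivity.
set (N := n x0 y0) in *.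
set (K := (Rabs A + Rabs B) / N * C).
assert (PK : 0 <= K).
{ apply Rmult_le_pos; [apply Rle_div_r; [lra | ] | lra].
  pose proof (Rabs_pos A); pose proof (Rabs_pos B); lra. }
(* The linearisation error of [f + i g] at [(x0, y0)], transported by the
   Lipschitz bound. *)
assert (main : forall eps : posreal, locally_2d (fun q p =>
  let m := Rmax (Rabs (q - q0)) (Rabs (p - p0)) in
  Rabs (A * (X q p - x0) - B * (Y q p - y0) - (q - q0)) <= eps * (C * m) /\
  Rabs (B * (X q p - x0) + A * (Y q p - y0) - (p - p0)) <= eps * (C * m)) q0 p0).
{ intros eps.
  destruct (F eps) as [dF HF]; destruct (G eps) as [dG HG].
  assert (Pm : 0 < Rmin dF dG) by (apply Rmin_pos; apply cond_pos).
  destruct (HcX (mkposreal _ Pm)) as [eX HX]; destruct (HcY (mkposreal _ Pm)) as [eY HY].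
  assert (Pe : 0 < Rmin d1 (Rmin eX eY)) by (repeat apply Rmin_pos; apply cond_pos).
  exists (mkposreal _ Pe); simpl pos; intros q p Hq Hp; cbv zeta.
  pose proof (Rmin_l d1 (Rmin eX eY)); pose proof (Rmin_r d1 (Rmin eX eY)).
  pose proof (Rmin_l eX eY); pose proof (Rmin_r eX eY).
  pose proof (Rmin_l dF dG); pose proof (Rmin_r dF dG).
  assert (BX : Rabs (X q p - x0) < Rmin dF dG) by (apply HX; lra).
  assert (BY : Rabs (Y q p - y0) < Rmin dF dG) by (apply HY; lra).
  specialize (HF (X q p) (Y q p)); specialize (HG (X q p) (Y q p)).
  destruct (fXY q p) as [E1 E2]; [apply HOd; lra | ].
  rewrite E1, Ef in HF; rewrite E2, Eg in HG.
  assert (Lmax : Rmax (Rabs (X q p - x0)) (Rabs (Y q p - y0))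
    <= C * Rmax (Rabs (q - q0)) (Rabs (p - p0))).
  { apply Rmax_lub; apply HLip; lra. }
  apply (Rmult_le_compat_l eps) in Lmax; [ | apply Rlt_le, cond_pos].
  split; (eapply Rle_trans; [ | exact Lmax]).
  - rewrite Rabs_minus_sym.
    replace (q - q0 - (A * (X q p - x0) - B * (Y q p - y0)))
      with (q - q0 - (A * (X q p - x0) + - B * (Y q p - y0))) by ring.
    apply HF; lra.
  - rewrite Rabs_minus_sym; apply HG; lra. }
split; intros eps.
- assert (Pe : 0 < eps / (K + 1)) by (apply Rdiv_lt_0_compat; [apply cond_pos | lra]).
  destruct (main (mkposreal _ Pe)) as [d Hd]; exists d; intros q p Hq Hp.
  destruct (Hd q p Hq Hp) as [E1 E2]; simpl pos in E1, E2.
  set (m := Rmax (Rabs (q - q0)) (Rabs (p - p0))) in *.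
  assert (Pmm : 0 <= m) by (eapply Rle_trans; [apply Rabs_pos | apply Rmax_l]).
  fold x0.
  replace (X q p - x0 - (A / N * (q - q0) + - - (B / N) * (p - p0))) with
    ((A * (A * (X q p - x0) - B * (Y q p - y0) - (q - q0))
      + B * (B * (X q p - x0) + A * (Y q p - y0) - (p - p0))) / N)
    by (rewrite HNe; field; lra).
  eapply Rle_trans; [now apply (Rabs_combination _ _ _ _ _ _ HN E1 E2) | ].
  replace ((Rabs A + Rabs B) / N * (eps / (K + 1) * (C * m))) with
    (K / (K + 1) * (eps * m)) by (unfold K at 1; field; lra).
  assert (K / (K + 1) <= 1) by (apply Rle_div_l; lra).
  assert (0 <= eps * m) by (apply Rmult_le_pos; [apply Rlt_le, cond_pos | trivial]).
  nra.
- assert (Pe : 0 < eps / (K + 1)) by (apply Rdiv_lt_0_compat; [apply cond_pos | lra]).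
  destruct (main (mkposreal _ Pe)) as [d Hd]; exists d; intros q p Hq Hp.
  destruct (Hd q p Hq Hp) as [E1 E2]; simpl pos in E1, E2.
  set (m := Rmax (Rabs (q - q0)) (Rabs (p - p0))) in *.
  assert (Pmm : 0 <= m) by (eapply Rle_trans; [apply Rabs_pos | apply Rmax_l]).
  fold y0.
  replace (Y q p - y0 - (- (B / N) * (q - q0) + A / N * (p - p0))) with
    ((A * (B * (X q p - x0) + A * (Y q p - y0) - (p - p0))
      + - B * (A * (X q p - x0) - B * (Y q p - y0) - (q - q0))) / N)
    by (rewrite HNe; field; lra).
  eapply Rle_trans; [now apply (Rabs_combination _ _ _ _ _ _ HN E2 E1) | rewrite Rabs_Ropp].
  replace ((Rabs A + Rabs B) / N * (eps / (K + 1) * (C * m))) with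
    (K / (K + 1) * (eps * m)) by (unfold K at 1; field; lra).
  assert (K / (K + 1) <= 1) by (apply Rle_div_l; lra).
  assert (0 <= eps * m) by (apply Rmult_le_pos; [apply Rlt_le, cond_pos | trivial]).
  nra.
Qed.

(** * Mean values of a periodic holomorphic function *)

Lemma continuity_2d_pt_slice (f : R -> R -> R) (x y : R) :
  continuity_2d_pt f x y -> continuous (fun t => f t y) x.
Proof.
intros H; apply continuity_pt_filterlim.
intros eps He; destruct (H (mkposreal _ He)) as [d Hd].
exists d; split; [apply cond_pos | ].
intros t [_ Ht]; apply Hd; [exact Ht | ].
rewrite Rminus_diag, Rabs_R0; apply cond_pos.
Qed.

(** Parameters are restricted to an open set [I] because the integrands below
    are only controlled in a half-plane. *)
Lemma is_derive_RInt_param_on (I : R -> Prop) (f df : R -> R -> R) (a b t0 : R) :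
  open I -> I t0 ->
  (forall q t, I t -> is_derive (fun s => f q s) t (df q t)) ->
  (forall q t, I t -> continuity_2d_pt df q t) ->
  (forall q t, I t -> continuous (fun s => f s t) q) ->
  is_derive (fun t => RInt (fun q => f q t) a b) t0 (RInt (fun q => df q t0) a b).
Proof.
intros HI I0 Hd Hc Hf.
assert (HL : locally t0 I) by now apply HI.
assert (HD : RInt (fun q => Derive (fun s => f q s) t0) a b
  = RInt (fun q => df q t0) a b).
{ apply RInt_ext; intros q _; now apply is_derive_unique, Hd. }
rewrite <- HD.
apply (is_derive_RInt_param (fun t q => f q t)).
- apply filter_imp with (2 := HL); intros t It q _; eexists; now apply Hd.
- intros q _.
  apply continuity_2d_pt_ext_loc with (fun t q => df q t).
  + destruct HL as [d HL]; exists d; intros t q' Ht _.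
    symmetry; apply is_derive_unique, Hd, HL, Ht.
  + intros eps; destruct (Hc q t0 I0 eps) as [d Hd']; exists d; intros u v Hu Hv.
    now apply Hd'.
- apply filter_imp with (2 := HL); intros t It.
  apply (ex_RInt_continuous (V := R_CompleteNormedModule)); intros; now apply Hf.
Qed.

Lemma is_derive_zero_const (f : R -> R) (a b : R) :
  (forall t, a <= t <= b -> is_derive f t 0) -> a <= b -> f b = f a.
Proof.
intros H Hab; destruct (MVT_cor4 f (fun _ => 0) ((a + b) / 2) ((b - a) / 2))
  with (b := a) as (c1 & E1 & _);
  [ | | destruct (MVT_cor4 f (fun _ => 0) ((a + b) / 2) ((b - a) / 2))
  with (b := b) as (c2 & E2 & _)]; try lra;
  try (intros c Hc; apply H; revert Hc; unfold Rabs; destruct Rcase_abs; lra);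
  unfold Rabs; destruct Rcase_abs; lra.
Qed.

Lemma open_upper_half_plane : open upper_half_plane.
Proof.
apply (open_comp snd (fun t => 0 < t)); [intros z _; apply continuous_snd | apply open_gt].
Qed.

Definition energy_integral (T : R) (a b : R -> R -> R) (p : R) : R :=
  RInt (fun q => a q p ^ 2 + b q p ^ 2) 0 T.

(** With [G = a + i b], the integral of [Re (G (q, p1 + t) * conj (G (q, p2 - t)))]
    over a period does not depend on [t]: its derivative is the integral of
    the [q]-derivative of [Im (conj (G (q, p1 + t)) * G (q, p2 - t))], by the
    Cauchy-Riemann equations.  Compare [t = 0] with [t = (p2 - p1) / 2]. *)
Lemma energy_integral_midpoint (T : R) (a b al be : R -> R -> R) (p1 p2 : R) :
  holomorphic_on upper_half_plane a b al be ->
  (forall p, 0 < p -> a T p = a 0 p /\ b T p = b 0 p) ->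
  0 < p1 -> p1 <= p2 ->
  energy_integral T a b ((p1 + p2) / 2)
  = RInt (fun q => a q p1 * a q p2 + b q p1 * b q p2) 0 T.
Proof.
intros Hh Hper P1 P12.
pose (f := fun q t => a q (p1 + t) * a q (p2 - t) + b q (p1 + t) * b q (p2 - t)).
pose (df := fun q t => (al q (p1 + t) * b q (p2 - t) + a q (p1 + t) * be q (p2 - t))
  - (be q (p1 + t) * a q (p2 - t) + b q (p1 + t) * al q (p2 - t))).
pose (I := fun t => 0 < p1 + t /\ 0 < p2 - t).
assert (HI : open I).
{ apply open_and; (apply (open_comp _ (fun t => 0 < t)); [ | apply open_gt]);
    intros t _; [apply (ex_derive_continuous (fun t => p1 + t))
                | apply (ex_derive_continuous (fun t => p2 - t))]; auto_derive; trivial. }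
assert (Hc : forall q p, 0 < p -> continuity_2d_pt a q p /\ continuity_2d_pt b q p /\
  continuity_2d_pt al q p /\ continuity_2d_pt be q p).
{ intros q p Pp; destruct (Hh q p Pp) as (Hd & ? & ?).
  destruct (complex_diff_continuity _ _ _ _ _ _ Hd); auto. }
assert (Hshift : forall k q t, (forall q p, 0 < p -> continuity_2d_pt k q p) -> I t ->
  continuity_2d_pt (fun q t => k q (p1 + t)) q t /\
  continuity_2d_pt (fun q t => k q (p2 - t)) q t).
{ intros k q t Hk [I1 I2]; split; apply continuity_2d_pt_comp; auto;
    try apply continuity_2d_pt_id1; [apply continuity_2d_pt_plus | apply continuity_2d_pt_minus];
    try apply continuity_2d_pt_const; apply continuity_2d_pt_id2. }
assert (Ca := fun q t => Hshift a q t (fun q p Pp => proj1 (Hc q p Pp))).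
assert (Cb := fun q t => Hshift b q t (fun q p Pp => proj1 (proj2 (Hc q p Pp)))).
assert (Cal := fun q t => Hshift al q t (fun q p Pp => proj1 (proj2 (proj2 (Hc q p Pp))))).
assert (Cbe := fun q t => Hshift be q t (fun q p Pp => proj2 (proj2 (proj2 (Hc q p Pp))))).
assert (Hdf : forall q t, I t -> continuity_2d_pt df q t).
{ intros q t It; unfold df; apply continuity_2d_pt_minus; apply continuity_2d_pt_plus;
    apply continuity_2d_pt_mult; first [now apply Ca | now apply Cb | now apply Cal
    | now apply Cbe]. }
assert (Hzero : forall t, I t -> RInt (fun q => df q t) 0 T = 0).
{ intros t It; apply is_RInt_unique.
  pose (W := fun q => a q (p1 + t) * b q (p2 - t) - b q (p1 + t) * a q (p2 - t)).
  replace 0 with (minus (W T) (W 0)) at 2.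
  - apply (is_RInt_derive W).
    + intros q _; destruct It as [I1 I2].
      destruct (Hh q _ I1) as ([F1 G1] & _); destruct (Hh q _ I2) as ([F2 G2] & _).
      apply differentiable_pt_lim_x in F1, G1, F2, G2.
      unfold W, df; auto_derive;
        [repeat split; trivial; eexists; eassumption | ].
      rewrite_derive; ring.
    + intros q _; now apply (continuity_2d_pt_slice df), Hdf.
  - destruct It as [I1 I2].
    destruct (Hper _ I1) as [A1 B1]; destruct (Hper _ I2) as [A2 B2].
    unfold W, minus, plus, opp; simpl; rewrite A1, B1, A2, B2; ring. }
assert (HK : forall t, I t -> is_derive (fun t => RInt (fun q => f q t) 0 T) t 0).
{ intros t It; evar_last; [ | exact (Hzero t It)].
  apply (is_derive_RInt_param_on I); trivial.
  - intros q s [I1 I2].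
    destruct (Hh q _ I1) as ([F1 G1] & _); destruct (Hh q _ I2) as ([F2 G2] & _).
    apply differentiable_pt_lim_y in F1, G1, F2, G2.
    unfold f, df; auto_derive; [repeat split; trivial; eexists; eassumption | ].
    rewrite_derive; change (p2 + - s) with (p2 - s); ring.
  - intros q s Is; apply (continuity_2d_pt_slice f).
    apply continuity_2d_pt_plus; apply continuity_2d_pt_mult;
      first [now apply Ca | now apply Cb]. }
transitivity (RInt (fun q => f q ((p2 - p1) / 2)) 0 T).
- enough (E : forall q, a q ((p1 + p2) / 2) ^ 2 + b q ((p1 + p2) / 2) ^ 2
    = f q ((p2 - p1) / 2)) by (apply RInt_ext; intros q _; apply E).
  intros q; unfold f.
  replace (p1 + (p2 - p1) / 2) with ((p1 + p2) / 2) by field.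
  replace (p2 - (p2 - p1) / 2) with ((p1 + p2) / 2) by field; ring.
- transitivity (RInt (fun q => f q 0) 0 T).
  + apply (is_derive_zero_const (fun t => RInt (fun q => f q t) 0 T)); [ | lra].
    intros t Ht; apply HK; unfold I; lra.
  + apply RInt_ext; intros q _; unfold f; now rewrite Rplus_0_r, Rminus_0_r.
Qed.

Lemma energy_integral_continuous (T : R) (a b al be : R -> R -> R) (p : R) :
  holomorphic_on upper_half_plane a b al be -> 0 < p ->
  continuity_pt (energy_integral T a b) p.
Proof.
intros Hh Pp; apply continuity_pt_filterlim.
apply (ex_derive_continuous (energy_integral T a b)); eexists.
assert (Hc : forall q t, 0 < t -> continuity_2d_pt a q t /\ continuity_2d_pt b q t).
{ intros q t Pt; destruct (Hh q t Pt) as (Hd & _); eapply complex_diff_continuity; eauto. }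
apply (is_derive_RInt_param_on (fun t => 0 < t) (fun q t => a q t ^ 2 + b q t ^ 2)
  (fun q t => 2 * (b q t * al q t - a q t * be q t))); trivial.
- apply open_gt.
- intros q t Pt; destruct (Hh q t Pt) as ([F G] & _).
  apply differentiable_pt_lim_y in F, G.
  auto_derive; [repeat split; trivial; eexists; eassumption | ].
  rewrite_derive; ring.
- intros q t Pt; destruct (Hh q t Pt) as (_ & ? & ?); destruct (Hc q t Pt).
  apply continuity_2d_pt_mult; [apply continuity_2d_pt_const | ].
  apply continuity_2d_pt_minus; now apply continuity_2d_pt_mult.
- intros q t Pt; destruct (Hc q t Pt).
  apply (continuity_2d_pt_slice (fun q t => a q t ^ 2 + b q t ^ 2)).
  now apply continuity_2d_pt_sum_squares.
Qed.

Lemma RInt_Cauchy_Schwarz (T : R) (a b a' b' : R -> R) :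
  0 <= T ->
  (forall q, continuous a q) -> (forall q, continuous b q) ->
  (forall q, continuous a' q) -> (forall q, continuous b' q) ->
  0 < RInt (fun q => a' q ^ 2 + b' q ^ 2) 0 T ->
  RInt (fun q => a q * a' q + b q * b' q) 0 T ^ 2 <=
  RInt (fun q => a q ^ 2 + b q ^ 2) 0 T * RInt (fun q => a' q ^ 2 + b' q ^ 2) 0 T.
Proof.
intros HT Ha Hb Ha' Hb' Pos.
assert (Hex : forall k : R -> R, (forall q, continuous k q) -> ex_RInt k 0 T).
{ intros k Hk; apply (ex_RInt_continuous (V := R_CompleteNormedModule)); auto. }
assert (Hprod : forall k l k' l' : R -> R, (forall q, continuous k q) ->
  (forall q, continuous l q) -> (forall q, continuous k' q) ->
  (forall q, continuous l' q) -> ex_RInt (fun q => k q * l q + k' q * l' q) 0 T).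
{ intros k l k' l' H1 H2 H3 H4; apply Hex; intros q.
  apply @continuous_plus; now apply @continuous_mult. }
assert (Hsq : forall k l : R -> R, (forall q, continuous k q) ->
  (forall q, continuous l q) -> ex_RInt (fun q => k q ^ 2 + l q ^ 2) 0 T).
{ intros k l H1 H2; apply ex_RInt_ext with (fun q => k q * k q + l q * l q); auto.
  intros; simpl; ring. }
set (M := RInt (fun q => a q ^ 2 + b q ^ 2) 0 T).
set (M' := RInt (fun q => a' q ^ 2 + b' q ^ 2) 0 T) in *.
set (K := RInt (fun q => a q * a' q + b q * b' q) 0 T).
(* The minimizer over [s] of the integral of [|G - s G'|^2]. *)
set (s := K / M').
assert (E : is_RInt (fun q => (a q - s * a' q) ^ 2 + (b q - s * b' q) ^ 2) 0 T
  (M + (- 2 * s) * K + s ^ 2 * M')).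
{ apply is_RInt_ext with (fun q => plus (plus (a q ^ 2 + b q ^ 2)
    (scal (- 2 * s) (a q * a' q + b q * b' q))) (scal (s ^ 2) (a' q ^ 2 + b' q ^ 2))).
  - intros q _; unfold plus, scal, mult; simpl; unfold mult; simpl; ring.
  - apply @is_RInt_plus; [apply @is_RInt_plus | ].
    + now apply (RInt_correct (V := R_CompleteNormedModule)), Hsq.
    + now apply @is_RInt_scal, (RInt_correct (V := R_CompleteNormedModule)), Hprod.
    + now apply @is_RInt_scal, (RInt_correct (V := R_CompleteNormedModule)), Hsq. }
assert (P : 0 <= M + (- 2 * s) * K + s ^ 2 * M').
{ apply (is_RInt_ge_0 _ 0 T _ HT E); intros q _.
  apply Rplus_le_le_0_compat; apply pow2_ge_0. }
replace (M + (- 2 * s) * K + s ^ 2 * M') with ((M * M' - K ^ 2) / M') in P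
  by (unfold s; field; lra).
assert (Q : 0 <= (M * M' - K ^ 2) / M' * M') by (apply Rmult_le_pos; lra).
replace ((M * M' - K ^ 2) / M' * M') with (M * M' - K ^ 2) in Q by (field; lra); lra.
Qed.

(** * Convexity on the half-line *)

(** On an interval the
    difference with the chord plus [eps * (x - a) * (x - b)] is strictly
    midpoint convex, so its maximum is at an end point; let [eps] tend to 0. *)
Lemma convex_on_of_midpoint (f : R -> R) :
  (forall p, 0 < p -> continuity_pt f p) ->
  (forall a b, 0 < a -> a <= b -> f ((a + b) / 2) <= (f a + f b) / 2) ->
  convex_on positive_reals f.
Proof.
intros Hc Hm.
assert (main : forall a b x, 0 < a -> a < x < b ->
  f x <= f a + (f b - f a) / (b - a) * (x - a)).
{ intros a b x Pa Hx.
  pose (h := fun y => f y - f a - (f b - f a) / (b - a) * (y - a)).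
  assert (Heps : forall eps, 0 < eps -> h x <= eps * ((x - a) * (b - x))).
  { intros eps Peps.
    pose (he := fun y => h y + eps * ((y - a) * (y - b))).
    destruct (continuity_ab_maj he a b) as (m & Hmax & Bm); [lra | | ].
    { intros c Hcc.
      assert (Hp : forall k : R -> R, ex_derive k c -> continuity_pt k c).
      { intros k Hk; now apply continuity_pt_filterlim, (ex_derive_continuous k). }
      apply (continuity_pt_plus h (fun y => eps * ((y - a) * (y - b)))).
      - apply (continuity_pt_minus (fun y => f y - f a)
          (fun y => (f b - f a) / (b - a) * (y - a))).
        + apply (continuity_pt_minus f (fun _ => f a)); [apply Hc; lra | ].
          apply Hp, ex_derive_const.
        + apply Hp; auto_derive; trivial.
      - apply Hp; auto_derive; trivial. }
    assert (Ea : he a = 0) by (unfold he, h; ring).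
    assert (Eb : he b = 0) by (unfold he, h; field; lra).
    assert (he m <= 0).
    { destruct (Req_dec m a) as [-> | Na]; [lra | ].
      destruct (Req_dec m b) as [-> | Nb]; [lra | ].
      exfalso; pose (d := Rmin (m - a) (b - m)).
      assert (Pd : 0 < d) by (apply Rmin_pos; lra).
      pose proof (Rmin_l (m - a) (b - m)); pose proof (Rmin_r (m - a) (b - m)).
      fold d in H, H0.
      pose proof (Hmax (m - d) ltac:(lra)) as M1; pose proof (Hmax (m + d) ltac:(lra)) as M2.
      pose proof (Hm (m - d) (m + d) ltac:(lra) ltac:(lra)) as MM.
      replace ((m - d + (m + d)) / 2) with m in MM by field.
      unfold he, h in M1, M2.
      set (k := (f b - f a) / (b - a)) in *.
      assert (0 < eps * (d * d)) by (repeat apply Rmult_lt_0_compat; lra).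
      nra. }
    pose proof (Hmax x ltac:(lra)) as Mx; unfold he in Mx at 1; lra. }
  assert (h x <= 0); [ | unfold h in *; lra].
  apply Rnot_lt_le; intros Hpos.
  assert (Pab : 0 < (x - a) * (b - x)) by (apply Rmult_lt_0_compat; lra).
  specialize (Heps (h x / (2 * ((x - a) * (b - x))))).
  replace (h x / (2 * ((x - a) * (b - x))) * ((x - a) * (b - x))) with (h x / 2)
    in Heps by (field; lra).
  assert (0 < h x / (2 * ((x - a) * (b - x)))) by (apply Rdiv_lt_0_compat; lra).
  lra. }
assert (main' : forall a b t, 0 < a -> a < b -> 0 < t < 1 ->
  f (t * a + (1 - t) * b) <= t * f a + (1 - t) * f b).
{ intros a b t Pa Hab Ht.
  eapply Rle_trans; [apply (main a b); trivial; nra | apply Req_le; field; lra]. }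
intros a b t Pa Pb Ht; unfold positive_reals in *.
destruct (Req_dec t 0) as [-> | N0].
{ replace (0 * a + (1 - 0) * b) with b by ring; lra. }
destruct (Req_dec t 1) as [-> | N1].
{ replace (1 * a + (1 - 1) * b) with a by ring; lra. }
destruct (Rtotal_order a b) as [Hab | [<- | Hab]].
- apply main'; lra.
- replace (t * a + (1 - t) * a) with a by ring; lra.
- pose proof (main' b a (1 - t) Pb Hab ltac:(lra)) as E.
  replace (1 - (1 - t)) with t in E by ring.
  rewrite (Rplus_comm (t * a)); lra.
Qed.

(** The tangent line of [exp] at the mean of the logarithms gives the weighted
    inequality between geometric and arithmetic means. *)
Lemma convex_on_of_ln (f : R -> R) :
  (forall p, 0 < p -> 0 < f p) ->
  convex_on positive_reals (fun p => ln (f p)) -> convex_on positive_reals f.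
Proof.
intros Hf Hl a b t Pa Pb Ht.
assert (Pm : 0 < t * a + (1 - t) * b).
{ unfold positive_reals in *; destruct (Req_dec t 0) as [-> | ]; [lra | ].
  assert (0 < t * a) by (apply Rmult_lt_0_compat; lra).
  assert (0 <= (1 - t) * b) by (apply Rmult_le_pos; lra); lra. }
pose (m := t * ln (f a) + (1 - t) * ln (f b)).
assert (tangent : forall p, 0 < p -> exp m * (1 + (ln (f p) - m)) <= f p).
{ intros p Pp; rewrite <- (exp_ln (f p)) at 2 by auto.
  replace (ln (f p)) with (m + (ln (f p) - m)) at 2 by ring; rewrite exp_plus.
  apply Rmult_le_compat_l; [apply Rlt_le, exp_pos | apply exp_ineq1_le]. }
rewrite <- (exp_ln (f (t * a + (1 - t) * b))) by auto.
apply Rle_trans with (exp m).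
- destruct (Hl a b t Pa Pb Ht) as [H | H].
  + now apply Rlt_le, exp_increasing.
  + cbv beta in H; rewrite H; apply Rle_refl.
- pose proof (tangent a Pa); pose proof (tangent b Pb).
  replace (exp m) with (t * (exp m * (1 + (ln (f a) - m)))
    + (1 - t) * (exp m * (1 + (ln (f b) - m)))) by (unfold m; ring).
  apply Rplus_le_compat; apply Rmult_le_compat_l; lra.
Qed.

(** A convex function that increases somewhere grows at least linearly. *)
Lemma convex_bounded_nonincreasing (f : R -> R) (p0 K : R) :
  convex_on positive_reals f -> (forall p, p0 <= p -> f p <= K) ->
  nonincreasing_on positive_reals f.
Proof.
intros Hf HK a b Pa Pb [Hab | <-]; [ | lra]; unfold positive_reals in *.
apply Rnot_lt_le; intros Hlt.
pose (d := f b - f a); pose (L := Rabs (K - f a)).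
assert (PL : 0 <= L /\ K - f a <= L) by (split; [apply Rabs_pos | apply Rle_abs]).
pose (x := b + Rabs p0 + (b - a) * (L + 1) / d).
assert (Pd : 0 < d) by (unfold d; lra).
assert (P0 : 0 < (b - a) * (L + 1) / d).
{ apply Rdiv_lt_0_compat; [apply Rmult_lt_0_compat | ]; lra. }
pose proof (Rabs_pos p0); pose proof (Rle_abs p0).
assert (Px : p0 <= x /\ b < x) by (unfold x; lra).
pose (t := (x - b) / (x - a)).
assert (Ht : 0 <= t <= 1).
{ unfold t; split; [apply Rle_div_r | apply Rle_div_l]; lra. }
pose proof (Hf a x t Pa ltac:(unfold positive_reals; lra) Ht) as C.
replace (t * a + (1 - t) * x) with b in C by (unfold t; field; lra).
pose proof (HK x (proj1 Px)).
assert (E : d * (x - a) <= (b - a) * (f x - f a)).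
{ replace ((b - a) * (f x - f a)) with ((1 - t) * (f x - f a) * (x - a))
    by (unfold t; field; lra).
  apply Rmult_le_compat_r; [lra | unfold d; lra]. }
assert (E2 : (b - a) * (L + 1) <= d * (x - a)).
{ replace ((b - a) * (L + 1)) with (d * ((b - a) * (L + 1) / d)) by (field; lra).
  apply Rmult_le_compat_l; [lra | unfold x; lra]. }
nra.
Qed.

(** * Logarithmic convexity of the means *)

Lemma energy_integral_pos (T : R) (a b al be : R -> R -> R) (p : R) :
  holomorphic_on upper_half_plane a b al be ->
  (forall q p, 0 < p -> 0 < a q p ^ 2 + b q p ^ 2) -> 0 < T -> 0 < p ->
  0 < energy_integral T a b p.
Proof.
intros Hh Hpos HT Pp; apply RInt_gt_0; trivial; [intros; now apply Hpos | intros q _].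
destruct (Hh q p Pp) as (Hd & _).
destruct (complex_diff_continuity _ _ _ _ _ _ Hd).
apply (continuity_2d_pt_slice (fun q t => a q t ^ 2 + b q t ^ 2)).
now apply continuity_2d_pt_sum_squares.
Qed.

(** The case of exponent 2 of Hardy's convexity theorem, for means over
    horizontal periods instead of circles.  The midpoint value is a scalar
    product of the two boundary functions, bounded by Cauchy-Schwarz. *)
Lemma energy_integral_log_convex (T k : R) (a b al be : R -> R -> R) :
  holomorphic_on upper_half_plane a b al be ->
  (forall p, 0 < p -> a T p = a 0 p /\ b T p = b 0 p) ->
  (forall q p, 0 < p -> 0 < a q p ^ 2 + b q p ^ 2) -> 0 < T -> 0 < k ->
  convex_on positive_reals (fun p => ln (k * energy_integral T a b p)).
Proof.
intros Hh Hper Hpos HT Pk.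
assert (PM : forall p, 0 < p -> 0 < energy_integral T a b p).
{ intros p Pp; eapply energy_integral_pos; eauto. }
assert (Hc : forall p q, 0 < p ->
  continuous (fun q => a q p) q /\ continuous (fun q => b q p) q).
{ intros p q Pp; destruct (Hh q p Pp) as (Hd & _).
  destruct (complex_diff_continuity _ _ _ _ _ _ Hd).
  split; now apply (continuity_2d_pt_slice). }
apply convex_on_of_midpoint.
- intros p Pp; specialize (PM p Pp); apply continuity_pt_filterlim.
  apply (continuous_comp (fun p => k * energy_integral T a b p) ln).
  + apply (continuous_scal_r (V := R_NormedModule) k).
    apply continuity_pt_filterlim; eapply energy_integral_continuous; eauto.
  + apply continuity_pt_filterlim, derivable_continuous_pt.
    exists (/ (k * energy_integral T a b p)).
    apply derivable_pt_lim_ln, Rmult_lt_0_compat; trivial.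
- intros p1 p2 P1 P12.
  assert (Pm : 0 < (p1 + p2) / 2) by lra; assert (P2 : 0 < p2) by lra.
  assert (CS := RInt_Cauchy_Schwarz T (fun q => a q p1) (fun q => b q p1)
    (fun q => a q p2) (fun q => b q p2)).
  assert (E : energy_integral T a b ((p1 + p2) / 2) ^ 2
    <= energy_integral T a b p1 * energy_integral T a b p2).
  { rewrite (energy_integral_midpoint T a b al be) by trivial.
    apply CS; try lra; try (intros q; now apply Hc). now apply PM. }
  pose proof (PM _ P1); pose proof (PM _ P2); pose proof (PM _ Pm).
  rewrite !ln_mult by trivial.
  apply ln_le in E; [ | now apply pow_lt].
  rewrite ln_mult in E by trivial.
  replace (energy_integral T a b ((p1 + p2) / 2) ^ 2) with
    (energy_integral T a b ((p1 + p2) / 2) * energy_integral T a b ((p1 + p2) / 2))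
    in E by ring.
  rewrite ln_mult in E by trivial; lra.
Qed.

(** * Powers on the right half-plane *)

Definition right_half_plane (w : R * R) : Prop := 0 < fst w.

Lemma open_right_half_plane : open right_half_plane.
Proof.
apply (open_comp fst (fun t => 0 < t)); [intros z _; apply continuous_fst | apply open_gt].
Qed.

(** The logarithm of [w / sqrt 2], so that its real part is half the logarithm
    of the energy when [w] is a velocity. *)
Lemma holomorphic_on_log :
  holomorphic_on right_half_plane
    (fun x y => ln ((x ^ 2 + y ^ 2) / 2) / 2) (fun x y => atan (y / x))
    (fun x y => x / (x ^ 2 + y ^ 2)) (fun x y => - (y / (x ^ 2 + y ^ 2))).
Proof.
assert (Hpos : forall x y, right_half_plane (x, y) ->
  0 < x /\ 0 < x * x + y * y /\ 0 < (x ^ 2 + y ^ 2) / 2).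
{ intros x y Hx; unfold right_half_plane in Hx; simpl in Hx; split; [trivial | split; nra]. }
assert (Hsq : forall x y, 1 + (y / x)² = 0 -> False).
{ intros x y; pose proof (Rle_0_sqr (y / x)); lra. }
assert (Hc : forall x y, right_half_plane (x, y) -> forall k, continuity_2d_pt k x y ->
  continuity_2d_pt (fun x y => k x y / (x ^ 2 + y ^ 2)) x y).
{ intros x y Hxy k Hk; destruct (Hpos x y Hxy) as (_ & Hn & _).
  apply continuity_2d_pt_mult; trivial; apply continuity_2d_pt_inv; [ | nra].
  apply (continuity_2d_pt_sum_squares (fun x _ => x) (fun _ y => y));
    [apply continuity_2d_pt_id1 | apply continuity_2d_pt_id2]. }
apply holomorphic_of_partials; try exact open_right_half_plane;
  intros x y Hxy; destruct (Hpos x y Hxy) as (Hx & Hn & He).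
- auto_derive; [simpl; nra | field; nra].
- auto_derive; [simpl; nra | field; nra].
- evar_last.
  + apply (is_derive_comp atan (fun t => y / t)); [apply is_derive_atan | ].
    auto_derive; [ | reflexivity]; lra.
  + unfold scal, Rsqr; simpl; unfold mult; simpl; field; split; [nra | lra].
- evar_last.
  + apply (is_derive_comp atan (fun t => t / x)); [apply is_derive_atan | ].
    auto_derive; [ | reflexivity]; lra.
  + unfold scal, Rsqr; simpl; unfold mult; simpl; field; split; [nra | lra].
- apply (Hc x y Hxy (fun x _ => x)), continuity_2d_pt_id1.
- apply continuity_2d_pt_opp, (Hc x y Hxy (fun _ y => y)), continuity_2d_pt_id2.
Qed.

Lemma holomorphic_on_exp (s : R) :
  holomorphic_on (fun _ => True)
    (fun x y => exp (s * x) * cos (s * y)) (fun x y => exp (s * x) * sin (s * y))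
    (fun x y => s * (exp (s * x) * cos (s * y)))
    (fun x y => s * (exp (s * x) * sin (s * y))).
Proof.
assert (Hc : forall k : R -> R, continuity k -> forall x y,
  continuity_2d_pt (fun x y => s * (exp (s * x) * k (s * y))) x y).
{ intros k Hk x y.
  apply continuity_2d_pt_mult; [apply continuity_2d_pt_const | ].
  apply continuity_2d_pt_mult.
  - apply (continuity_1d_2d_pt_comp exp (fun x _ => s * x)).
    + apply derivable_continuous_pt, derivable_pt_exp.
    + apply continuity_2d_pt_mult; [apply continuity_2d_pt_const | apply continuity_2d_pt_id1].
  - apply (continuity_1d_2d_pt_comp k (fun _ y => s * y)); [apply Hk | ].
    apply continuity_2d_pt_mult; [apply continuity_2d_pt_const | apply continuity_2d_pt_id2]. }
apply holomorphic_of_partials; try apply open_true; intros x y _.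
1-4: auto_derive; [trivial | ring].
- apply Hc, continuity_cos.
- apply Hc, continuity_sin.
Qed.

(** * Stokes waves *)

(** Stopping the argument at the free surface turns one-sided continuity there
    into continuity on the line, so that the mean value and intermediate value
    theorems apply up to the surface. *)
Lemma continuous_on_vertical_slice (eta : R -> R) (psi : R -> R -> R) (x : R) :
  continuous_on (fluid_closure eta) (fun z => psi (fst z) (snd z)) ->
  continuity (fun t => psi x (Rmin t (eta x))).
Proof.
intros H t; apply continuity_pt_filterlim.
pose (k := fun t => (x, Rmin t (eta x))).
assert (Hk : fluid_closure eta (k t)) by apply Rmin_r.
apply (filterlim_comp _ _ _ k (fun z => psi (fst z) (snd z)) (locally t)
  (within (fluid_closure eta) (locally (k t))) _); [ | now apply H].
intros Q [d Hd]; exists d; intros s Hs; apply Hd; [ | apply Rmin_r].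
split; [apply ball_center | ].
unfold ball in *; simpl in *; unfold AbsRing_ball, abs, minus, plus, opp in *.
simpl in *; revert Hs; unfold Rmin; do 2 destruct Rle_dec;
  unfold Rabs; repeat destruct Rcase_abs; lra.
Qed.

Lemma is_derive_vertical_slice (eta : R -> R) (psi : R -> R -> R) (x t l : R) :
  t < eta x -> is_derive (fun t => psi x t) t l ->
  is_derive (fun t => psi x (Rmin t (eta x))) t l.
Proof.
intros Ht; apply is_derive_ext_loc.
apply filter_imp with (fun s => s < eta x).
- intros s Hs; now rewrite Rmin_left by lra.
- now apply open_lt.
Qed.

Lemma stokes_eta_le_crest (c lambda g Patm : R) (eta : R -> R) (u v P : R -> R -> R) :
  0 < lambda -> stokes_wave c lambda g Patm eta u v P -> forall x, eta x <= eta 0.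
Proof.
intros Hl W.
assert (base : forall x, 0 <= x <= lambda / 2 -> eta x <= eta 0).
{ intros x [[H0 | <-] H1]; [ | lra].
  apply Rlt_le, (sw_eta_decr _ _ _ _ _ _ _ _ W); lra. }
assert (main : forall n x, Rabs x <= lambda / 2 + INR n * lambda -> eta x <= eta 0).
{ induction n as [ | n IH]; intros x Hx.
  - simpl in Hx; revert Hx; unfold Rabs; destruct Rcase_abs; intros Hx.
    + rewrite <- (sw_eta_even _ _ _ _ _ _ _ _ W x); apply base; lra.
    + apply base; lra.
  - rewrite S_INR in Hx.
    assert (0 <= INR n * lambda) by (apply Rmult_le_pos; [apply pos_INR | lra]).
    destruct (Rlt_le_dec (lambda / 2) x) as [H1 | H1].
    + replace x with (x - lambda + lambda) by ring.
      rewrite (sw_eta_periodic _ _ _ _ _ _ _ _ W); apply IH.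
      revert Hx; unfold Rabs; repeat destruct Rcase_abs; lra.
    + destruct (Rlt_le_dec x (- lambda / 2)) as [H2 | H2].
      * rewrite <- (sw_eta_periodic _ _ _ _ _ _ _ _ W); apply IH.
        revert Hx; unfold Rabs; repeat destruct Rcase_abs; lra.
      * apply IH; unfold Rabs; destruct Rcase_abs; lra. }
intros x; destruct (INR_archimed lambda (Rabs x) Hl) as [n Hn].
apply (main n); lra.
Qed.

Lemma open_fluid_domain (eta : R -> R) :
  (forall x, ex_derive eta x) -> open (fluid_domain eta).
Proof.
intros He [x y] Hxy; unfold fluid_domain in *; simpl in *.
assert (Pe : 0 < (eta x - y) / 2) by lra.
assert (C : continuous eta x) by (apply (ex_derive_continuous eta), He).
apply continuity_pt_filterlim in C.
destruct (C _ Pe) as (d & Pd & Hd).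
assert (Pm : 0 < Rmin d ((eta x - y) / 2)) by (now apply Rmin_pos).
exists (mkposreal _ Pm); intros [x' y'] [H1 H2].
pose proof (Rmin_l d ((eta x - y) / 2)); pose proof (Rmin_r d ((eta x - y) / 2)).
unfold ball in *; simpl in *; unfold AbsRing_ball, abs, minus, plus, opp in *.
simpl in *.
assert (E : Rabs (eta x' - eta x) < (eta x - y) / 2).
{ destruct (Req_dec x x') as [-> | N]; [rewrite Rminus_diag, Rabs_R0; lra | ].
  apply Hd; split; [split; [exact I | exact N] | ].
  change (Rabs (x' + - x) < d); lra. }
revert E H2; unfold Rabs; repeat destruct Rcase_abs; lra.
Qed.

(** Incompressibility and irrotationality are the Cauchy-Riemann equations of
    [c - u + i v]. *)
Lemma stokes_velocity_holomorphic (c lambda g Patm : R) (eta : R -> R)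
    (u v P : R -> R -> R) :
  stokes_wave c lambda g Patm eta u v P ->
  holomorphic_on (fluid_domain eta) (fun x y => c - u x y) v
    (fun x y => - partial_x u x y) (partial_x v).
Proof.
intros W; apply holomorphic_of_partials.
- apply open_fluid_domain, (sw_eta_diff _ _ _ _ _ _ _ _ W).
- intros x y Dxy; destruct (sw_u_C1 _ _ _ _ _ _ _ _ W x y Dxy) as (_ & Hx & _).
  auto_derive; [now repeat split | unfold partial_x; ring].
- intros x y Dxy; destruct (sw_u_C1 _ _ _ _ _ _ _ _ W x y Dxy) as (_ & _ & Hy & _).
  pose proof (sw_irrotational _ _ _ _ _ _ _ _ W x y Dxy) as E; unfold partial_y in E.
  auto_derive; [now repeat split | lra].
- intros x y Dxy; destruct (sw_v_C1 _ _ _ _ _ _ _ _ W x y Dxy) as (_ & Hx & _).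
  now apply Derive_correct.
- intros x y Dxy; destruct (sw_v_C1 _ _ _ _ _ _ _ _ W x y Dxy) as (_ & _ & Hy & _).
  pose proof (sw_incompressible _ _ _ _ _ _ _ _ W x y Dxy) as E.
  replace (- partial_x u x y) with (partial_y v x y) by lra.
  now apply Derive_correct.
- intros x y Dxy; destruct (sw_u_C1 _ _ _ _ _ _ _ _ W x y Dxy) as (_ & _ & _ & (C & _) & _).
  now apply continuity_2d_pt_opp.
- intros x y Dxy; now destruct (sw_v_C1 _ _ _ _ _ _ _ _ W x y Dxy) as (_ & _ & _ & (C & _) & _).
Qed.

(** The relations that define the stream function and the potential are the
    Cauchy-Riemann equations of the hodograph transform. *)
Lemma stokes_hodograph_holomorphic (c lambda g Patm : R) (eta : R -> R)
    (u v P psi phi : R -> R -> R) :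
  stokes_wave c lambda g Patm eta u v P ->
  stream_function c eta u v psi -> velocity_potential c lambda eta psi phi ->
  holomorphic_on (fluid_domain eta) phi psi
    (fun x y => u x y - c) (fun x y => - v x y).
Proof.
intros W S V; apply holomorphic_of_partials.
- apply open_fluid_domain, (sw_eta_diff _ _ _ _ _ _ _ _ W).
- intros x y Dxy; rewrite <- (is_derive_unique _ _ _ (sf_y _ _ _ _ _ S x y Dxy)).
  apply (vp_x _ _ _ _ _ V x y Dxy).
- intros x y Dxy; rewrite <- (is_derive_unique _ _ _ (sf_x _ _ _ _ _ S x y Dxy)).
  apply (vp_y _ _ _ _ _ V x y Dxy).
- apply (sf_x _ _ _ _ _ S).
- apply (sf_y _ _ _ _ _ S).
- intros x y Dxy; destruct (sw_u_C1 _ _ _ _ _ _ _ _ W x y Dxy) as (C & _).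
  apply continuity_2d_pt_minus; [exact C | apply continuity_2d_pt_const].
- intros x y Dxy; destruct (sw_v_C1 _ _ _ _ _ _ _ _ W x y Dxy) as (C & _).
  now apply continuity_2d_pt_opp.
Qed.

Lemma stream_vertical_increment (c : R) (eta : R -> R) (u v psi : R -> R -> R)
    (x y y' : R) :
  stream_function c eta u v psi -> y <= y' -> y' <= eta x ->
  exists t, y <= t <= y' /\ psi x y - psi x y' = (c - u x t) * (y' - y).
Proof.
intros S H1 H2.
destruct (MVT_gen (fun t => psi x (Rmin t (eta x))) y' y (fun t => u x t - c))
  as (t & Bt & E).
- intros t; rewrite Rmin_right, Rmax_left by lra; intros Ht.
  apply is_derive_vertical_slice; [lra | apply (sf_y _ _ _ _ _ S); lra].
- intros t _; apply (continuous_on_vertical_slice eta psi x (sf_cont _ _ _ _ _ S)).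
- rewrite Rmin_right, Rmax_left in Bt by lra.
  rewrite !Rmin_left in E by lra; exists t; split; [lra | rewrite E; ring].
Qed.

(** On a vertical line the stream function vanishes at the surface and, as the
    velocity tends to [(0, 0)], grows like [- c * y] at depth. *)
Lemma stream_vertical_onto (c lambda g Patm : R) (eta : R -> R)
    (u v P psi : R -> R -> R) (x p : R) :
  0 < c -> stokes_wave c lambda g Patm eta u v P -> stream_function c eta u v psi ->
  0 < p -> exists y, y < eta x /\ psi x y = p.
Proof.
intros Hc W S Pp.
destruct (sw_deep _ _ _ _ _ _ _ _ W (c / 2)) as [Y HY]; [lra | ].
pose (y0 := Rmin Y (eta x)).
assert (B0 : y0 <= Y /\ y0 <= eta x) by (split; [apply Rmin_l | apply Rmin_r]).
(* Below [y0] the stream function decreases in [y] at a rate at least [c / 2]. *)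
pose (y1 := y0 - 2 * (Rabs (psi x y0) + p) / c).
assert (Pd : 0 < 2 * (Rabs (psi x y0) + p) / c).
{ apply Rdiv_lt_0_compat; [pose proof (Rabs_pos (psi x y0)); lra | lra]. }
assert (B1 : y1 < y0) by (unfold y1; lra).
assert (Hp : p <= psi x y1).
{ destruct (stream_vertical_increment c eta u v psi x y1 y0 S) as (t & Bt & E); try lra.
  destruct (HY x t) as [Hu _]; [lra | lra | ].
  apply Rabs_lt_between in Hu.
  assert (c / 2 * (y0 - y1) = Rabs (psi x y0) + p) by (unfold y1; field; lra).
  pose proof (Rle_abs (- psi x y0)) as A; rewrite Rabs_Ropp in A.
  nra. }
destruct (IVT_gen (fun t => psi x (Rmin t (eta x))) y1 (eta x) p) as (y & By & Ey).
- apply continuous_on_vertical_slice, (sf_cont _ _ _ _ _ S).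
- rewrite (Rmin_left y1), (Rmin_left (eta x) (eta x)), (sf_surface _ _ _ _ _ S) by lra.
  rewrite Rmin_right, Rmax_left by lra; lra.
- exists y.
  assert (y < eta x).
  { apply Rnot_le_lt; intros H; rewrite Rmin_right, (sf_surface _ _ _ _ _ S) in Ey by lra; lra. }
  split; [trivial | now rewrite Rmin_left in Ey by lra].
Qed.

(** The difference of the two sides has derivative [0] in [y], by periodicity of
    [u], and vanishes at the surface. *)
Lemma stream_trough_periodic (c lambda g Patm : R) (eta : R -> R)
    (u v P psi : R -> R -> R) (y : R) :
  stokes_wave c lambda g Patm eta u v P -> stream_function c eta u v psi ->
  y < eta (- lambda / 2) -> psi (lambda / 2) y = psi (- lambda / 2) y.
Proof.
intros W S Hy.
assert (E : - lambda / 2 + lambda = lambda / 2) by field.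
assert (Ee : eta (lambda / 2) = eta (- lambda / 2)).
{ rewrite <- E; apply (sw_eta_periodic _ _ _ _ _ _ _ _ W). }
set (k := fun x t => psi x (Rmin t (eta x))).
destruct (MVT_gen (fun t => k (lambda / 2) t - k (- lambda / 2) t)
  y (eta (- lambda / 2)) (fun _ => 0)) as (t & _ & Et).
- intros t; rewrite Rmin_left, Rmax_right by lra; intros Ht.
  evar_last.
  + apply @is_derive_minus; apply is_derive_vertical_slice; try lra;
      apply (sf_y _ _ _ _ _ S); lra.
  + rewrite <- E, (sw_u_periodic _ _ _ _ _ _ _ _ W) by lra.
    unfold minus, plus, opp; simpl; ring.
- intros t _; apply continuity_pt_minus;
    apply continuous_on_vertical_slice, (sf_cont _ _ _ _ _ S).
- unfold k in Et; rewrite Ee, !Rmin_left in Et by lra.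
  rewrite <- Ee in Et at 1; rewrite !(sf_surface _ _ _ _ _ S) in Et; lra.
Qed.

(** The lines [q = 0] and [q = c * lambda] are the images of two consecutive
    trough lines, on which the stream function takes the same values: this turns
    periodicity in [x] into periodicity in [q]. *)
Lemma stokes_velocity_periodic (c lambda g Patm : R) (eta : R -> R)
    (u v P psi phi : R -> R -> R) (hinv : R * R -> R * R) (p : R) :
  0 < c -> stokes_wave c lambda g Patm eta u v P ->
  stream_function c eta u v psi -> velocity_potential c lambda eta psi phi ->
  inverse_between (fluid_domain eta) upper_half_plane (hodograph phi psi) hinv ->
  0 < p -> exists y,
    hinv (c * lambda, p) = (- lambda / 2, y) /\ hinv (0, p) = (lambda / 2, y) /\
    u (lambda / 2) y = u (- lambda / 2) y /\ v (lambda / 2) y = v (- lambda / 2) y.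
Proof.
intros Hc W S V Hinv Pp.
assert (E : - lambda / 2 + lambda = lambda / 2) by field.
assert (Ee : eta (lambda / 2) = eta (- lambda / 2)).
{ rewrite <- E; apply (sw_eta_periodic _ _ _ _ _ _ _ _ W). }
destruct (stream_vertical_onto c lambda g Patm eta u v P psi (- lambda / 2) p)
  as (y & Hy & Ey); trivial.
exists y.
assert (Ey' : psi (lambda / 2) y = p).
{ rewrite <- Ey; eapply stream_trough_periodic; eauto. }
split; [ | split; [ | split]].
- rewrite <- (ib_left _ _ _ _ Hinv (- lambda / 2, y)) by exact Hy.
  unfold hodograph; simpl; now rewrite (vp_left _ _ _ _ _ V), Ey.
- rewrite <- (ib_left _ _ _ _ Hinv (lambda / 2, y))
    by (unfold fluid_domain; simpl; lra).
  unfold hodograph; simpl; now rewrite (vp_right _ _ _ _ _ V), Ey' by lra.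
- rewrite <- E; apply (sw_u_periodic _ _ _ _ _ _ _ _ W); lra.
- rewrite <- E; apply (sw_v_periodic _ _ _ _ _ _ _ _ W); lra.
Qed.

(** At depth [d] below the surface the stream function is at most [(M + c) * d],
    where [M] bounds the velocity; so a large value forces a large depth, where
    [|u|] and [|v|] are below [c / 2]. *)
Lemma stokes_energy_deep (c lambda g Patm : R) (eta : R -> R)
    (u v P psi phi : R -> R -> R) (hinv : R * R -> R * R) :
  0 < c -> 0 < lambda -> stokes_wave c lambda g Patm eta u v P ->
  stream_function c eta u v psi ->
  inverse_between (fluid_domain eta) upper_half_plane (hodograph phi psi) hinv ->
  exists p0, 0 < p0 /\ forall q p, p0 <= p ->
    c ^ 2 / 8 <= kinetic_energy c u v (hinv (q, p)) <= 2 * c ^ 2.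
Proof.
intros Hc Hl W S Hinv.
destruct (sw_bounded _ _ _ _ _ _ _ _ W) as [M HM].
destruct (sw_deep _ _ _ _ _ _ _ _ W (c / 2)) as [Y HY]; [lra | ].
assert (PM : 0 <= M).
{ destruct (HM 0 (eta 0)) as [H _]; [lra | pose proof (Rabs_pos (u 0 (eta 0))); lra]. }
exists (Rabs ((M + c) * (eta 0 - Y)) + 1).
split; [pose proof (Rabs_pos ((M + c) * (eta 0 - Y))); lra | ].
intros q p Hp.
assert (Pp : upper_half_plane (q, p)).
{ unfold upper_half_plane; simpl; pose proof (Rabs_pos ((M + c) * (eta 0 - Y))); lra. }
pose proof (ib_inv_maps _ _ _ _ Hinv _ Pp) as Dz.
pose proof (ib_right _ _ _ _ Hinv _ Pp) as Ez.
destruct (hinv (q, p)) as [x y]; unfold fluid_domain, hodograph in *; simpl in *.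
injection Ez as _ Ep.
destruct (stream_vertical_increment c eta u v psi x y (eta x) S) as (t & Bt & E); try lra.
rewrite (sf_surface _ _ _ _ _ S), Ep in E.
destruct (HM x t) as [Hu _]; [lra | ]; apply Rabs_le_between in Hu.
pose proof (stokes_eta_le_crest c lambda g Patm eta u v P Hl W x).
pose proof (Rle_abs ((M + c) * (eta 0 - Y))).
assert (HyY : y <= Y).
{ apply Rnot_lt_le; intros Hlt.
  assert ((c - u x t) * (eta x - y) <= (M + c) * (eta 0 - Y)); [ | lra].
  apply Rmult_le_compat; try lra.
  pose proof (sw_no_stagnation _ _ _ _ _ _ _ _ W x t ltac:(lra)); lra. }
destruct (HY x y) as [Bu Bv]; [lra | trivial | ].
apply Rabs_lt_between in Bu; apply Rabs_lt_between in Bv.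
unfold kinetic_energy; simpl; nra.
Qed.

Lemma Rpower_bounded (s m M : R) :
  0 < m -> exists K, forall x, m <= x <= M -> Rpower x s <= K.
Proof.
intros Pm; exists (exp (Rabs s * (Rabs (ln m) + Rabs (ln M)))); intros x Hx.
assert (E : s * ln x <= Rabs s * (Rabs (ln m) + Rabs (ln M))).
{ eapply Rle_trans; [apply Rle_abs | rewrite Rabs_mult].
  apply Rmult_le_compat_l; [apply Rabs_pos | ].
  pose proof (ln_le m x Pm ltac:(lra)); pose proof (ln_le x M ltac:(lra) ltac:(lra)).
  unfold Rabs; repeat destruct Rcase_abs; lra. }
unfold Rpower; destruct E as [E | E]; [now apply Rlt_le, exp_increasing | rewrite E; lra].
Qed.

Theorem theorem2p1
  (c lambda g Patm : R) (hc : 0 < c) (hlambda : 0 < lambda) (hg : 0 < g)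
  (eta : R -> R) (u v P : R -> R -> R)
  (hwave : stokes_wave c lambda g Patm eta u v P)
  (psi phi : R -> R -> R)
  (hpsi : stream_function c eta u v psi)
  (hphi : velocity_potential c lambda eta psi phi)
  (hinv : R * R -> R * R)
  (hhinv : inverse_between (fluid_domain eta) upper_half_plane
             (hodograph phi psi) hinv)
  (s : R) (hs : s <= - (1 / 2) \/ 1 / 2 <= s) :
  let mu := integral_mean c lambda hinv s (kinetic_energy c u v) in
  convex_on positive_reals mu /\
  nonincreasing_on positive_reals mu /\
  convex_on positive_reals (fun p => ln (mu p)).
Proof.
intros mu.
pose (X := fun q p => fst (hinv (q, p))); pose (Y := fun q p => snd (hinv (q, p))).
pose (W1 := fun q p => c - u (X q p) (Y q p)); pose (W2 := fun q p => v (X q p) (Y q p)).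
pose (L := fun q p => ln ((W1 q p ^ 2 + W2 q p ^ 2) / 2) / 2).
pose (Th := fun q p => atan (W2 q p / W1 q p)).
(* [A + i B] is the power [s] of [(c - u + i v) / sqrt 2] in the hodograph plane. *)
pose (A := fun q p => exp (s * L q p) * cos (s * Th q p)).
pose (B := fun q p => exp (s * L q p) * sin (s * Th q p)).
assert (HD : forall q p, upper_half_plane (q, p) -> fluid_domain eta (X q p, Y q p)).
{ intros q p Hp; unfold X, Y; rewrite <- surjective_pairing.
  now apply (ib_inv_maps _ _ _ _ hhinv). }
assert (HAB : exists al be, holomorphic_on upper_half_plane A B al be).
{ assert (HXY := holomorphic_on_inverse _ _ _ _ _ _ hinv
    (open_fluid_domain eta (sw_eta_diff _ _ _ _ _ _ _ _ hwave)) open_upper_half_plane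
    (stokes_hodograph_holomorphic _ _ _ _ _ _ _ _ _ _ hwave hpsi hphi)
    ltac:(intros x y Dxy;
      pose proof (sw_no_stagnation _ _ _ _ _ _ _ _ hwave x y (Rlt_le _ _ Dxy));
      apply Rgt_not_eq; nra) hhinv).
  assert (HW := holomorphic_on_comp _ _ _ _ _ _ X Y _ _ HD
    (stokes_velocity_holomorphic _ _ _ _ _ _ _ _ hwave) HXY).
  assert (Hright : forall q p, upper_half_plane (q, p) ->
    right_half_plane (W1 q p, W2 q p)).
  { intros q p Hp; unfold right_half_plane, W1; simpl.
    pose proof (sw_no_stagnation _ _ _ _ _ _ _ _ hwave (X q p) (Y q p)
      (Rlt_le _ _ (HD q p Hp))); lra. }
  assert (HL := holomorphic_on_comp _ _ _ _ _ _ W1 W2 _ _ Hright holomorphic_on_log HW).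
  assert (HA := holomorphic_on_comp _ (fun _ => True) _ _ _ _ L Th _ _ (fun _ _ _ => I)
    (holomorphic_on_exp s) HL).
  exact (ex_intro _ _ (ex_intro _ _ HA)). }
destruct HAB as (al & be & HAB).
assert (HE : forall q p,
  A q p ^ 2 + B q p ^ 2 = Rpower (kinetic_energy c u v (hinv (q, p))) s).
{ intros q p; pose proof (sin2_cos2 (s * Th q p)) as E; unfold Rsqr in E.
  unfold A, B; transitivity (exp (s * L q p) * exp (s * L q p)).
  - transitivity (exp (s * L q p) * exp (s * L q p) *
      (sin (s * Th q p) * sin (s * Th q p) + cos (s * Th q p) * cos (s * Th q p)));
      [ring | rewrite E; ring].
  - rewrite <- exp_plus; unfold Rpower, kinetic_energy, L, W1, W2, X, Y.
    replace ((c - u (fst (hinv (q, p))) (snd (hinv (q, p)))) ^ 2)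
      with ((u (fst (hinv (q, p))) (snd (hinv (q, p))) - c) ^ 2) by ring.
    f_equal; field. }
assert (Hper : forall p, 0 < p -> A (c * lambda) p = A 0 p /\ B (c * lambda) p = B 0 p).
{ intros p Pp.
  destruct (stokes_velocity_periodic c lambda g Patm eta u v P psi phi hinv p)
    as (y & E1 & E2 & Eu & Ev); trivial.
  unfold A, B, L, Th, W1, W2, X, Y; rewrite E1, E2; simpl; now rewrite Eu, Ev. }
assert (Hpos : forall q p, 0 < p -> 0 < A q p ^ 2 + B q p ^ 2).
{ intros q p _; rewrite HE; apply exp_pos. }
assert (PT : 0 < c * lambda) by now apply Rmult_lt_0_compat.
assert (Pk : 0 < / (c * lambda)) by now apply Rinv_0_lt_compat.
assert (Hmu : forall p, / (c * lambda) * energy_integral (c * lambda) A B p = mu p).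
{ intros p; unfold mu, integral_mean, energy_integral; f_equal.
  apply RInt_ext; intros q _; apply HE. }
assert (Hlog : convex_on positive_reals (fun p => ln (mu p))).
{ intros p1 p2 t; rewrite <- !Hmu.
  apply (energy_integral_log_convex _ _ _ _ _ _ HAB Hper Hpos PT Pk). }
assert (Hmupos : forall p, 0 < p -> 0 < mu p).
{ intros p Pp; rewrite <- Hmu; apply Rmult_lt_0_compat; trivial.
  eapply energy_integral_pos; eauto. }
assert (Hconv : convex_on positive_reals mu) by now apply convex_on_of_ln.
split; [exact Hconv | split; [ | exact Hlog]].
destruct (stokes_energy_deep c lambda g Patm eta u v P psi phi hinv)
  as (p0 & P0 & Hdeep); trivial.
destruct (Rpower_bounded s (c ^ 2 / 8) (2 * c ^ 2)) as [K HK]; [nra | ].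
apply (convex_bounded_nonincreasing mu p0 K Hconv); intros p Hp.
assert (Pp : 0 < p) by lra.
rewrite <- Hmu; apply (Rmult_le_reg_l (c * lambda)); trivial.
rewrite <- Rmult_assoc, Rinv_r, Rmult_1_l by lra.
assert (EK : RInt (fun _ => K) 0 (c * lambda) = c * lambda * K).
{ rewrite RInt_const; unfold scal; simpl; unfold mult; simpl; ring. }
rewrite <- EK; apply RInt_le; [lra | | apply ex_RInt_const | ].
- apply (ex_RInt_continuous (V := R_CompleteNormedModule)); intros q _.
  destruct (HAB q p Pp) as (Hd & _).
  destruct (complex_diff_continuity _ _ _ _ _ _ Hd).
  apply (continuity_2d_pt_slice (fun q t => A q t ^ 2 + B q t ^ 2)).
  now apply continuity_2d_pt_sum_squares.
- intros q _; rewrite HE; apply HK, Hdeep, Hp.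
Qed.
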